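(* Let $\lambda,\mu,\theta,\gamma>0$, $p\in[0,1]$, and let $c$ be a positive integer. For each $n\ge 1$ let $(Q^n,S^n)$ be the $n$-th scaled Erlang--$S^*$ process described in the context, and set $\bar Q^n(t)=Q^n(t)/n$, $\bar S^n(t)=S^n(t)/n$. Assume that $\bar Q^n(0)\Rightarrow q(0)$ and $\bar S^n(0)\Rightarrow s(0)$ as $n\to\infty$, where $q(0),s(0)$ are deterministic. Then for every fixed $T>0$, $$\sup_{0\le t\le T}\big\|(\bar Q^n(t),\bar S^n(t))-(q(t),s(t))\big\|\xrightarrow{P}0\qquad (n\to\infty),$$ where $(q(t),s(t))$ is the unique solution on $[0,T]$, with initial value $(q(0),s(0))$, of $$\frac{dq(t)}{dt}=\lambda-\mu\min\{q(t),s(t)\}-\theta\,(q(t)-s(t))^+,\qquad \frac{ds(t)}{dt}=\gamma\,(c-s(t))-p\mu\min\{q(t),s(t)\}.$$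
   Context: Let $N_A,N_B,N_C,N_{Ab}$ be independent unit-rate Poisson processes and let $(\xi_i)_{i\ge1}$ be i.i.d. Bernoulli($p$) random variables independent of them. The $n$-th scaled Erlang--$S^*$ process $(Q^n,S^n)$, with values in $\mathbb{Z}_{\ge0}\times\{0,1,\dots,nc\}$ ($Q^n$ is the number of customers, $S^n$ the number of active servers, $nc-S^n$ the number of charging servers), is the solution of $$Q^n(t)=Q^n(0)+N_A(\lambda n t)-N_B\Big(\mu\int_0^t\min\{Q^n(u),S^n(u)\}\,du\Big)-N_{Ab}\Big(\theta\int_0^t(Q^n(u)-S^n(u))^+du\Big),$$ $$S^n(t)=S^n(0)+N_C\Big(\gamma\int_0^t(nc-S^n(u))\,du\Big)-\sum_{i=1}^{N_B(\mu\int_0^t\min\{Q^n(u),S^n(u)\}du)}\xi_i.$$ Here $x^+=\max\{x,0\}$, $\Rightarrow$ denotes convergence in distribution, $\xrightarrow{P}$ convergence in probability, and $\|\cdot\|$ is any norm on $\mathbb{R}^2$. *)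

(* Defs.v *)
From HB Require Import structures.
From mathcomp Require Import all_boot all_order all_algebra finmap.
From mathcomp Require Import all_classical all_reals all_analysis measurable_realfun.

Set Implicit Arguments.
Unset Strict Implicit.
Unset Printing Implicit Defensive.

Import Order.TTheory GRing.Theory Num.Theory.
Import numFieldNormedType.Exports.

Local Open Scope classical_set_scope.
Local Open Scope ring_scope.

Section Norm.
Context {R : realType} {V : lmodType R}.

Definition is_norm (nu : V -> R) : Prop :=
  [/\ forall x y, nu (x + y) <= nu x + nu y,
      forall a x, nu (a *: x) = `|a| * nu x
    & forall x, nu x = 0 -> x = 0].

End Norm.

Section Probability.
Context {d : measure_display} {Omega : measurableType d} {R : realType}.
Variable P : probability Omega R.

Definition mutually_independent (I : choiceType)
    (F : I -> set (set Omega)) : Prop :=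
  forall (J : {fset I}) (E : I -> set Omega), (forall i, i \in J -> F i (E i)) ->
    P (\bigcap_(i in [set` J]) E i) = (\prod_(i <- J) P (E i))%E.

Definition sigma_gen (J : Type) (D : set J) d' (E : measurableType d')
    (X : J -> Omega -> E) : set (set Omega) :=
  <<s \bigcup_(j in D) preimage_set_system setT (X j) measurable >>.

Definition iid_bernoulli (p : R) (xi : nat -> Omega -> bool) : Prop :=
  [/\ forall i, measurable_fun setT (xi i),
      forall i b, P (xi i @^-1` [set b]) = (bernoulli_pmf p b)%:E
    & mutually_independent
        (fun i => preimage_set_system setT (xi i) measurable)].

(* Only the values [N t] with [0 <= t] are constrained. As the paths are almost
   surely nondecreasing, the truncated subtraction of [nat] almost surely
   computes the actual increments. *)
Record unit_poisson_process (N : R -> Omega -> nat) : Prop := {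
  pp_measurable : forall t : R, 0 <= t -> measurable_fun setT (N t);
  pp_paths : {ae P, forall w,
    [/\ N 0 w = 0%N,
        forall s t : R, 0 <= s -> s <= t -> (N s w <= N t w)%N
      & forall t : R, 0 <= t -> \forall s \near t^'+, N s w = N t w]};
  pp_increments : forall (s t : R) (k : nat), 0 <= s -> s < t ->
    P [set w | (N t w - N s w)%N = k] = (poisson_pmf (t - s) k)%:E;
  pp_independent : forall u : nat -> R, 0 <= u 0%N ->
    (forall i, u i <= u i.+1) ->
    mutually_independent (fun i =>
      preimage_set_system setT (fun w => (N (u i.+1) w - N (u i) w)%N)
        measurable) }.

Definition cvg_in_distribution (X : nat -> Omega -> R) (Y : Omega -> R) : Prop :=
  forall f : R -> R, continuous f -> bounded_fun f ->
    ('E_P[f \o X n])%E @[n --> \oo] --> ('E_P[f \o Y])%E.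

(* [P] is only meaningful on measurable sets, hence the first condition. *)
Definition cvg_in_probability (X : nat -> Omega -> \bar R) (l : R) : Prop :=
  (\forall n \near \oo, measurable_fun setT (X n)) /\
  (forall e : R, 0 < e ->
    P [set w | (e%:E < `|X n w - l%:E|)%E] @[n --> \oo] --> 0%E).

End Probability.

Section ErlangSstar.
Context {d : measure_display} {Omega : measurableType d} {R : realType}.
Variable P : probability Omega R.

(* The Bernoulli variables are indexed from 0: [xi i] is the (i+1)-st one. *)
Definition erlang_drivers (p : R) (NA NB NC NAb : R -> Omega -> nat)
    (xi : nat -> Omega -> bool) : Prop :=
  [/\ unit_poisson_process P NA /\ unit_poisson_process P NB,
      unit_poisson_process P NC /\ unit_poisson_process P NAb,
      iid_bernoulli P p xi
    & mutually_independent P (tnth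
        [tuple sigma_gen [set t | 0 <= t] NA;
               sigma_gen [set t | 0 <= t] NB;
               sigma_gen [set t | 0 <= t] NC;
               sigma_gen [set t | 0 <= t] NAb;
               sigma_gen setT xi])].

Definition service_clock (mu : R) (Q S : R -> Omega -> nat) (t : R) (w : Omega)
    : R :=
  mu * \int[lebesgue_measure]_(u in `[0, t]) (minn (Q u w) (S u w))%:R.

Definition abandonment_clock (theta : R) (Q S : R -> Omega -> nat) (t : R)
    (w : Omega) : R :=
  theta * \int[lebesgue_measure]_(u in `[0, t])
    Num.max ((Q u w)%:R - (S u w)%:R) 0.

Definition charging_clock (gamma : R) (m : nat) (S : R -> Omega -> nat) (t : R)
    (w : Omega) : R :=
  gamma * \int[lebesgue_measure]_(u in `[0, t]) (m%:R - (S u w)%:R).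

(* Only times [0 <= t] are constrained. Path regularity (which a solution has
   automatically up to null sets) makes the time integrals and the suprema over
   time intervals well defined for every outcome. *)
Record erlang_Sstar (lambda mu theta gamma : R) (c n : nat)
    (NA NB NC NAb : R -> Omega -> nat) (xi : nat -> Omega -> bool)
    (Q S : R -> Omega -> nat) : Prop := {
  es_measurable : forall t : R, 0 <= t ->
    measurable_fun setT (Q t) /\ measurable_fun setT (S t);
  es_right_continuous : forall w (t : R), 0 <= t ->
    \forall u \near t^'+, Q u w = Q t w /\ S u w = S t w;
  es_range : forall w (t : R), 0 <= t -> (S t w <= n * c)%N;
  es_equations : {ae P, forall w, forall t : R, 0 <= t ->
    (Q t w)%:R = (Q 0 w)%:R + (NA (lambda * n%:R * t) w)%:R
      - (NB (service_clock mu Q S t w) w)%:R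
      - (NAb (abandonment_clock theta Q S t w) w)%:R :> R
    /\
    (S t w)%:R = (S 0 w)%:R + (NC (charging_clock gamma (n * c) S t w) w)%:R
      - \sum_(i < NB (service_clock mu Q S t w) w) (xi i w)%:R :> R} }.

End ErlangSstar.

Section FluidLimit.
Context {R : realType}.

Definition fluid_solution (lambda mu theta gamma p : R) (c : nat) (q0 s0 T : R)
    (q s : R -> R) : Prop :=
  [/\ q 0 = q0 /\ s 0 = s0,
      derivable_oo_LRcontinuous q 0 T, derivable_oo_LRcontinuous s 0 T
    & forall t : R, 0 < t < T ->
        derive1 q t = lambda - mu * Num.min (q t) (s t)
                  - theta * Num.max (q t - s t) 0
        /\ derive1 s t = gamma * (c%:R - s t) - p * mu * Num.min (q t) (s t)].

End FluidLimit.

Section Deviation.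
Context {Omega : Type} {R : realType}.

Definition sup_deviation (nu : R * R -> R) (T : R) (X Y : R -> Omega -> R)
    (q s : R -> R) (w : Omega) : \bar R :=
  ereal_sup [set (nu ((X t w, Y t w) - (q t, s t)))%:E | t in `[0, T]].

End Deviation.

(* Main.v *)
Require Import Defs.
From mathcomp Require Import all_boot all_order all_algebra finmap.
From mathcomp Require Import all_classical all_reals all_analysis measurable_realfun.
From mathcomp Require Import ring lra.
Import Order.TTheory GRing.Theory Num.Theory.
Import numFieldNormedType.Exports.
Local Open Scope classical_set_scope.
Local Open Scope ring_scope.

(** Dividing the two defining equations by [n] and writing [X = Q / n],
[Y = S / n], every driving process appears as [N (n x) / n] at a clock value
[x] that is an integral of the path: for example the services completed up to
time [t] are [NB (n x) / n] with [x = mu * \int_0^t min (X, Y)].  If each such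
term is replaced by its mean [x], and the sum of the first [k] Bernoulli
variables by [p k], the pair [(X, Y)] satisfies the integral form of the fluid
equation exactly.  So there are only two things to prove.

The replacement costs little.  By Chebyshev's inequality [N (n x) / n] tends to
[x] in probability for a fixed [x] ([poisson_lln]), and likewise for the
Bernoulli sums ([bernoulli_lln]); both processes are nondecreasing and have a
continuous limit, so the convergence is uniform on compact sets
([whp_monotone_uniform]).  The clocks stay in a compact set independent of [n]
because [Y <= c] and because [X] is at most the initial content plus the
arrivals ([clock_bound]).  The finitely many events so obtained, each of
probability tending to one, are then intersected ([whp_and]).

A small perturbation of the integral equation moves the solution little.  The
drift is globally Lipschitz with a constant [L], so two paths that solve the
equation up to errors of size at most [delta] differ by at most
[2 delta exp (2 L t)] ([ode_stability], from [gronwall]).  Applied to two exact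
solutions this gives uniqueness, applied to [(X, Y)] and [(q, s)] it gives the
limit ([pathwise_fluid_bound]); existence of [(q, s)] is Picard iteration
([picard_lindelof]).

Weighting by [exp (- 2 L t)] makes the integral operator a contraction of ratio
[1/2]; this one computation ([Rintegral_expR_bound]) drives both Gronwall's
inequality and Picard's iteration. *)

(** * Bounded measurable functions on a time interval and Gronwall's inequality *)

Lemma geometric_eventually_le {R : realType} (C e : R) : 0 < e ->
  exists k, forall m, (k <= m)%N -> C / 2 ^+ m <= e.
Proof.
move=> e0; have := @cvg_geometric R C (2^-1).
rewrite ger0_norm// => /(_ _)/cvgrPdist_le/(_ e e0)[|k _ H].
  by rewrite invf_lt1// ltr1n.
exists k => m km; have := H m km; rewrite /geometric/= sub0r normrN exprVn.
exact: le_trans (ler_norm _).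
Qed.

Lemma le_geometric_eq0 {R : realType} (a C : R) :
  (forall k, `|a| <= C / 2 ^+ k) -> a = 0.
Proof.
move=> aC; apply/eqP; rewrite -normr_le0; apply/ler_addgt0Pr => e e0; rewrite add0r.
have [k /(_ k (leqnn k))] := geometric_eventually_le C e e0.
exact: le_trans.
Qed.

Section BoundedMeasurable.
Context {R : realType}.
Notation leb := (@lebesgue_measure R).

(** The class in which all integrals below are taken: sample paths jump, so
continuity would be too strong a requirement. *)
Definition bounded_measurable (T : R) (f : R -> R) : Prop :=
  measurable_fun `[0, T] f /\
  exists M : R, forall t : R, 0 <= t <= T -> `|f t| <= M.

Lemma itv_0T (T t : R) : (`[0, T]%classic t) = (0 <= t <= T).
Proof. by rewrite /= in_itv. Qed.

Lemma Rintegral_cst_0t (t a : R) : 0 <= t -> \int[leb]_(u in `[0, t]) a = a * t.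
Proof.
move=> t0; rewrite Rintegral_cst; last exact: measurable_itv.
congr (a * _); have := lebesgue_measure_itv `[0, t]; rewrite /= lte_fin => ->.
case: ifPn => /=; first by rewrite subr0.
by rewrite -leNgt => ?; apply/le_anti/andP.
Qed.

Lemma bounded_measurable_integrable (T t : R) f : bounded_measurable T f ->
  t <= T -> leb.-integrable `[0, t] (EFin \o f).
Proof.
move=> [mf [M fM]] tT.
have sub : `[0, t] `<=` (`[0, T] : set R).
  by apply: subset_itvl; rewrite bnd_simp.
apply: measurable_bounded_integrable => //.
- by rewrite /= lebesgue_measure_itv/=; case: ifPn; rewrite ?ltry.
- exact: measurable_funS mf.
- exists M; split; first exact: num_real.
  move=> x Mx y /sub; rewrite itv_0T => yT.
  exact: le_trans (fM _ yT) (ltW Mx).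
Qed.

Lemma bounded_measurable_cst (T a : R) : bounded_measurable T (fun=> a).
Proof. by split; [exact: measurable_cst|exists `|a|]. Qed.

Lemma bounded_measurableD (T : R) f g : bounded_measurable T f ->
  bounded_measurable T g -> bounded_measurable T (fun t => f t + g t).
Proof.
move=> [mf [M fM]] [mg [M' gM]]; split; first exact: measurable_funD.
exists (M + M') => t tT; apply: le_trans (ler_normD _ _) _.
by apply: lerD; [exact: fM|exact: gM].
Qed.

Lemma bounded_measurableZ (T a : R) f : bounded_measurable T f ->
  bounded_measurable T (fun t => a * f t).
Proof.
move=> [mf [M fM]]; split; first exact: measurable_funM.
exists (`|a| * M) => t tT; rewrite normrM.
by apply: ler_wpM2l => //; exact: fM.
Qed.

Lemma bounded_measurableB (T : R) f g : bounded_measurable T f ->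
  bounded_measurable T g -> bounded_measurable T (fun t => f t - g t).
Proof.
move=> hf hg; under eq_fun do rewrite -mulN1r.
by apply: bounded_measurableD => //; exact: bounded_measurableZ.
Qed.

Lemma bounded_measurable_RintegralD (T t : R) f g : t <= T ->
  bounded_measurable T f -> bounded_measurable T g ->
  \int[leb]_(u in `[0, t]) (f u + g u)
  = \int[leb]_(u in `[0, t]) f u + \int[leb]_(u in `[0, t]) g u.
Proof.
by move=> tT hf hg; rewrite RintegralD//; exact: (bounded_measurable_integrable T).
Qed.

Lemma bounded_measurable_RintegralB (T t : R) f g : t <= T ->
  bounded_measurable T f -> bounded_measurable T g ->
  \int[leb]_(u in `[0, t]) (f u - g u)
  = \int[leb]_(u in `[0, t]) f u - \int[leb]_(u in `[0, t]) g u.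
Proof.
by move=> tT hf hg; rewrite RintegralB//; exact: (bounded_measurable_integrable T).
Qed.

Lemma bounded_measurable_RintegralZ (T t a : R) f : t <= T -> bounded_measurable T f ->
  \int[leb]_(u in `[0, t]) (a * f u) = a * \int[leb]_(u in `[0, t]) f u.
Proof.
by move=> tT hf; rewrite RintegralZl//; exact: (bounded_measurable_integrable T).
Qed.

Lemma bounded_measurable_norm (T : R) f : bounded_measurable T f ->
  bounded_measurable T (fun t => `|f t|).
Proof.
move=> [mf [M fM]]; split; first exact: measurableT_comp.
by exists M => t tT; rewrite normr_id; exact: fM.
Qed.

Lemma bounded_measurable_within (T : R) (f : R -> R) :
  {within `[0, T], continuous f} -> bounded_measurable T f.
Proof.
move=> cf; split; first exact: subspace_continuous_measurable_fun.
have /compact_bounded [M [_ +]] : compact (f @` `[0, T]).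
  apply: continuous_compact cf _; exact: segment_compact.
move=> /(_ (M + 1)); rewrite ltrDl ltr01 => /(_ isT) H; exists (M + 1) => t tT.
apply: H; by exists t => //; rewrite itv_0T.
Qed.

(** Extending [f] and [g] by [0] outside [D] reduces the claim to functions on
the whole line. *)
Lemma measurable_fun_pair_comp (D : set R) (b : R * R -> R) (f g : R -> R) :
  measurable D -> measurable_fun setT b -> measurable_fun D f ->
  measurable_fun D g -> measurable_fun D (fun t => b (f t, g t)).
Proof.
move=> mD mb mf mg.
have mh : measurable_fun setT (fun t => b ((f \_ D) t, (g \_ D) t)).
  apply: measurableT_comp => //; apply: measurable_fun_pair;
    by apply/(measurable_restrictT _ _).1.
apply: (eq_measurable_fun (fun t => b ((f \_ D) t, (g \_ D) t))).
  by move=> t tD; rewrite !patchE tD.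
exact: measurable_funS mh.
Qed.

(** Integration followed by multiplication by [L] halves the constant in front
of the weight [exp (2 L u)]: the primitive of the weight is [1 / (2 L)] times
the weight. *)
Lemma Rintegral_expR_bound (T t L K : R) (phi : R -> R) :
  0 < L -> 0 <= K -> 0 <= t <= T -> bounded_measurable T phi ->
  (forall u : R, 0 <= u <= t -> phi u <= K * expR (L *+ 2 * u)) ->
  L * \int[leb]_(u in `[0, t]) phi u <= K / 2 * (expR (L *+ 2 * t) - 1).
Proof.
move=> L0 K0 /andP[t0 tT] hphi phiK.
move: t0; rewrite le_eqVlt => /predU1P[<-|t0].
  by rewrite set_itv1 Rintegral_set1 mulr0 mulr0 expR0 subrr mulr0.
pose F (u : R) := K / 2 / L * expR (L *+ 2 * u).
have dF (u : R) : is_derive u 1 F (K * expR (L *+ 2 * u)).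
  rewrite /F; apply: is_derive_eq.
  rewrite !(scalerAl, mulr_algl) /GRing.scale/= ?mulr1.
  have L1 : L != 0 by rewrite gt_eqF.
  by field.
have cF : continuous F.
  by move=> u; apply/differentiable_continuous/derivable1_diffP; case: (dF u).
have cE : continuous (fun u : R => K * expR (L *+ 2 * u)).
  move=> u; apply: cvgM; first exact: cvg_cst.
  apply: continuous_comp; last exact: continuous_expR.
  by apply: cvgM; [exact: cvg_cst|exact: cvg_id].
have : (\int[leb]_(u in `[0%R, t]) (K * expR (L *+ 2 * u))%:E)%E
    = ((F t)%:E - (F 0)%:E)%E.
  apply: continuous_FTC2 => //.
  - exact: continuous_subspaceT.
  - split; first by move=> u _; case: (dF u).
    + exact: cvg_at_right_filter (cF _).
    + exact: cvg_at_left_filter (cF _).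
  - by move=> u _; rewrite derive1E; apply: (@derive_val _ _ _ _ _ _ _ (dF u)).
move=> hint.
have : \int[leb]_(u in `[0, t]) phi u
    <= \int[leb]_(u in `[0, t]) (K * expR (L *+ 2 * u)).
  apply: le_Rintegral => //.
  - exact: bounded_measurable_integrable hphi tT.
  - apply: (@bounded_measurable_integrable t) => //.
    by apply/bounded_measurable_within/continuous_subspaceT.
rewrite [X in _ <= X]/Rintegral hint /= => /(ler_wpM2l (ltW L0)).
move=> /le_trans; apply; rewrite /F mulr0 expR0.
have L1 : L != 0 by rewrite gt_eqF.
by rewrite le_eqVlt; apply/orP; left; apply/eqP; field.
Qed.

(** Valid for discontinuous [phi], where no differentiation of the integral is
possible.  Feeding a bound [(2 delta + C) exp (2 L t)] into the hypothesis
returns the same bound with [C / 2]; the iteration starts from a crude bound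
[M] of [phi]. *)
Lemma gronwall (T L delta : R) (phi : R -> R) :
  0 < L -> 0 <= delta -> bounded_measurable T phi ->
  (forall t : R, 0 <= t <= T ->
     phi t <= delta + L * \int[leb]_(u in `[0, t]) phi u) ->
  forall t : R, 0 <= t <= T -> phi t <= delta *+ 2 * expR (L *+ 2 * t).
Proof.
move=> L0 d0 hphi ineq.
have [M phiM] := hphi.2.
have M0 (u : R) : 0 <= u <= T -> 0 <= M by move=> /phiM; apply: le_trans.
have expR_ge1 (u : R) : 0 <= u -> 1 <= expR (L *+ 2 * u).
  by move=> u0; rewrite -expR0 ler_expR mulr_ge0// mulrn_wge0// ltW.
have iter k (t : R) : 0 <= t <= T ->
    phi t <= (delta *+ 2 + M / 2 ^+ k) * expR (L *+ 2 * t).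
  elim: k t => [|k IH] t tT; have M0' := M0 _ tT.
    rewrite expr0 divr1; have /andP[t0 _] := tT.
    apply: le_trans (ler_norm _) _; apply: le_trans (phiM _ tT) _.
    have := expR_ge1 _ t0; set e := expR _ => e1.
    by nra.
  have /andP[t0 t_T] := tT.
  apply: le_trans (ineq _ tT) _.
  have C0 : 0 <= M / 2 ^+ k by rewrite divr_ge0// exprn_ge0.
  have := @Rintegral_expR_bound T t L (delta *+ 2 + M / 2 ^+ k) phi L0.
  move=> /(_ _ tT hphi) H.
  apply: (@le_trans _ _ (delta + (delta *+ 2 + M / 2 ^+ k) / 2 *
     (expR (L *+ 2 * t) - 1))).
    rewrite lerD2l; apply: H; first by rewrite addr_ge0// mulrn_wge0.
    move=> u /andP[u0 ut]; apply: IH; by rewrite u0 (le_trans ut).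
  have -> : M / 2 ^+ k.+1 = M / 2 ^+ k / 2.
    by rewrite exprS; field; rewrite expf_neq0.
  by have := expR_ge1 _ t0; set e := expR _ => e1; nra.
move=> t tT; have M0' := M0 _ tT.
apply/ler_addgt0Pr => e e0.
have [k /(_ k (leqnn k)) hk] := geometric_eventually_le (M * expR (L *+ 2 * t)) e e0.
apply: le_trans (iter k t tT) _; rewrite mulrDl lerD2l.
by rewrite mulrAC.
Qed.

End BoundedMeasurable.

(** * Globally Lipschitz planar differential equations *)

(** [u k] minus and plus twice the [k]-th step bound are respectively
nondecreasing and nonincreasing sequences, and the limit is the supremum of the
former. *)
Lemma geometric_steps_limit {R : realType} (u : nat -> R) (C : R) :
  (forall k, `|u k.+1 - u k| <= C / 2 ^+ k) ->
  exists l, forall k, `|l - u k| <= C *+ 2 / 2 ^+ k.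
Proof.
move=> uC.
have C2 k : C *+ 2 / 2 ^+ k.+1 = C / 2 ^+ k.
  by rewrite exprS; field; rewrite expf_neq0.
have C22 k : C *+ 2 / 2 ^+ k = C / 2 ^+ k + C / 2 ^+ k by rewrite mulrnAl mulr2n.
pose lo k := u k - C *+ 2 / 2 ^+ k.
pose hi k := u k + C *+ 2 / 2 ^+ k.
have ndlo : {homo lo : m n / (m <= n)%N >-> m <= n}.
  apply/nondecreasing_seqP => k; rewrite /lo C2 C22.
  by have := uC k; rewrite ler_norml; lra.
have nihi : {homo hi : m n / (m <= n)%N >-> n <= m}.
  apply/nonincreasing_seqP => k; rewrite /hi C2 C22.
  by have := uC k; rewrite ler_norml; lra.
have C0 : 0 <= C *+ 2.
  rewrite mulrn_wge0//; have := le_trans (normr_ge0 _) (uC 0%N).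
  by rewrite expr0 divr1.
have lohi m n : lo m <= hi n.
  apply: le_trans (ndlo _ _ (leq_maxl m n)) _.
  apply: le_trans (nihi _ _ (leq_maxr m n)).
  by rewrite /lo /hi lerBlDr -addrA lerDl addr_ge0// divr_ge0// exprn_ge0.
have hs : has_sup (range lo).
  split; first by exists (lo 0%N), 0%N.
  by exists (hi 0%N) => _ [m _ <-].
exists (sup (range lo)) => k; rewrite ler_norml; apply/andP; split.
  rewrite lerBrDl -/(lo k); exact: sup_upper_bound.
rewrite lerBlDl -/(hi k); apply: ge_sup; first by exists (lo 0%N), 0%N.
by move=> _ [m _ <-].
Qed.

Section PlanarODE.
Context {R : realType}.
Notation leb := (@lebesgue_measure R).
Variables (b1 b2 : R * R -> R) (L : R).
Hypothesis L0 : 0 < L.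
Hypothesis b_lip : forall z z' : R * R,
  `|b1 z - b1 z'| + `|b2 z - b2 z'| <= L * (`|z.1 - z'.1| + `|z.2 - z'.2|).
Hypothesis mb1 : measurable_fun setT b1.
Hypothesis mb2 : measurable_fun setT b2.

Let lip1 z z' : `|b1 z - b1 z'| <= L * (`|z.1 - z'.1| + `|z.2 - z'.2|).
Proof. by apply: le_trans (b_lip z z'); rewrite lerDl. Qed.

Let lip2 z z' : `|b2 z - b2 z'| <= L * (`|z.1 - z'.1| + `|z.2 - z'.2|).
Proof. by apply: le_trans (b_lip z z'); rewrite lerDr. Qed.

Lemma bounded_measurable_lip (b : R * R -> R) (T : R) x y :
  measurable_fun setT b ->
  (forall z z', `|b z - b z'| <= L * (`|z.1 - z'.1| + `|z.2 - z'.2|)) ->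
  bounded_measurable T x -> bounded_measurable T y ->
  bounded_measurable T (fun t => b (x t, y t)).
Proof.
move=> mb lip [mx [M xM]] [my [N yN]]; split.
  exact: measurable_fun_pair_comp.
exists (`|b (0, 0)| + L * (M + N)) => t tT.
have := lip (x t, y t) (0, 0); rewrite /= !subr0 => H.
rewrite -[b _](subrK (b (0, 0))); apply: le_trans (ler_normD _ _) _.
rewrite addrC lerD2l; apply: le_trans H _; rewrite ler_pM2l//.
by apply: lerD; [exact: xM|exact: yN].
Qed.

(** Continuity of a Lipschitz field, in the form that serves interior points and
one-sided limits at the end points alike. *)
Lemma cvg_lip (b : R * R -> R) (F : set_system R) (x y : R -> R) (l m : R) :
  Filter F ->
  (forall z z', `|b z - b z'| <= L * (`|z.1 - z'.1| + `|z.2 - z'.2|)) ->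
  x @ F --> l -> y @ F --> m -> (fun t => b (x t, y t)) @ F --> b (l, m).
Proof.
move=> FF lip /cvgrPdist_le xl /cvgrPdist_le ym; apply/cvgrPdist_le => e e0.
have d0 : 0 < e / (L *+ 2) by rewrite divr_gt0// mulrn_wgt0.
near=> t; apply: le_trans (lip _ _) _ => /=.
have -> : e = L * (e / (L *+ 2) + e / (L *+ 2)).
  by field; rewrite gt_eqF.
rewrite ler_pM2l//; apply: lerD; near: t; [exact: xl|exact: ym].
Unshelve. all: by end_near. Qed.

Lemma drift_integral_lip (T t : R) x y x' y' : 0 <= t <= T ->
  bounded_measurable T x -> bounded_measurable T y ->
  bounded_measurable T x' -> bounded_measurable T y' ->
  `|\int[leb]_(u in `[0, t]) b1 (x u, y u)
    - \int[leb]_(u in `[0, t]) b1 (x' u, y' u)| +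
  `|\int[leb]_(u in `[0, t]) b2 (x u, y u)
    - \int[leb]_(u in `[0, t]) b2 (x' u, y' u)|
  <= L * \int[leb]_(u in `[0, t]) (`|x u - x' u| + `|y u - y' u|).
Proof.
move=> /andP[_ tT] hx hy hx' hy'.
have bmi := fun f hf => @bounded_measurable_integrable _ T t f hf tT.
have h1 := bounded_measurable_lip b1 T x y mb1 lip1 hx hy.
have h2 := bounded_measurable_lip b2 T x y mb2 lip2 hx hy.
have h1' := bounded_measurable_lip b1 T x' y' mb1 lip1 hx' hy'.
have h2' := bounded_measurable_lip b2 T x' y' mb2 lip2 hx' hy'.
have hd1 := bounded_measurableB T _ _ h1 h1'.
have hd2 := bounded_measurableB T _ _ h2 h2'.
rewrite -(bounded_measurable_RintegralB T t _ _ tT h1 h1').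
rewrite -(bounded_measurable_RintegralB T t _ _ tT h2 h2').
apply: (@le_trans _ _ (\int[leb]_(u in `[0, t])
   (`|b1 (x u, y u) - b1 (x' u, y' u)| + `|b2 (x u, y u) - b2 (x' u, y' u)|))).
  rewrite (bounded_measurable_RintegralD T t _ _ tT
    (bounded_measurable_norm _ _ hd1) (bounded_measurable_norm _ _ hd2)).
  by apply: lerD; apply: le_normr_Rintegral => //; exact: bmi.
have hphi : bounded_measurable T (fun u => `|x u - x' u| + `|y u - y' u|).
  by apply: bounded_measurableD; apply: bounded_measurable_norm;
    exact: bounded_measurableB.
rewrite -RintegralZl//; last exact: bmi.
apply: le_Rintegral => //.
- by apply: bmi; apply: bounded_measurableD; exact: bounded_measurable_norm.
- by apply: bmi; exact: bounded_measurableZ.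
Qed.

(** The two pairs satisfy the same integral equation up to [delta]; the distance
between them is then at most [delta] plus [L] times its own integral, which is
the hypothesis of [gronwall].  Exact solutions are the case [delta = 0]. *)
Lemma ode_stability (T delta : R) x y x' y' :
  bounded_measurable T x -> bounded_measurable T y ->
  bounded_measurable T x' -> bounded_measurable T y' ->
  (forall t : R, 0 <= t <= T ->
     `|x t - x' t - (\int[leb]_(u in `[0, t]) b1 (x u, y u)
        - \int[leb]_(u in `[0, t]) b1 (x' u, y' u))| +
     `|y t - y' t - (\int[leb]_(u in `[0, t]) b2 (x u, y u)
        - \int[leb]_(u in `[0, t]) b2 (x' u, y' u))| <= delta) ->
  forall t : R, 0 <= t <= T ->
    `|x t - x' t| + `|y t - y' t| <= delta *+ 2 * expR (L *+ 2 * t).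
Proof.
move=> hx hy hx' hy' H t tT.
have hphi : bounded_measurable T (fun u => `|x u - x' u| + `|y u - y' u|).
  by apply: bounded_measurableD; apply: bounded_measurable_norm;
    exact: bounded_measurableB.
have d0 : 0 <= delta by apply: le_trans (H _ tT); rewrite addr_ge0.
apply: (gronwall T L delta (fun u => `|x u - x' u| + `|y u - y' u|)) => //.
move=> {tT}t tT.
have := drift_integral_lip T t x y x' y' tT hx hy hx' hy'.
have := H _ tT.
set i1 := Rintegral _ _ _; set i2 := Rintegral _ _ _.
set i3 := Rintegral _ _ _; set i4 := Rintegral _ _ _; set i5 := Rintegral _ _ _.
have := ler_normD (x t - x' t - (i1 - i2)) (i1 - i2); rewrite subrK.
have := ler_normD (y t - y' t - (i3 - i4)) (i3 - i4); rewrite subrK.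
by lra.
Qed.

Section Picard.
Variables (T x0 y0 : R).
Hypothesis T0 : 0 <= T.

Fixpoint picard (k : nat) : (R -> R) * (R -> R) :=
  if k is k'.+1 then
    let: (x, y) := picard k' in
    ((fun t => x0 + \int[leb]_(u in `[0, t]) b1 (x u, y u)),
     (fun t => y0 + \int[leb]_(u in `[0, t]) b2 (x u, y u)))
  else (fun=> x0, fun=> y0).

Lemma picardS k :
  (forall t, (picard k.+1).1 t =
     x0 + \int[leb]_(u in `[0, t]) b1 ((picard k).1 u, (picard k).2 u)) /\
  (forall t, (picard k.+1).2 t =
     y0 + \int[leb]_(u in `[0, t]) b2 ((picard k).1 u, (picard k).2 u)).
Proof. by rewrite /=; case: (picard k). Qed.

Lemma bounded_measurable_primitive a f : bounded_measurable T f ->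
  bounded_measurable T (fun t => a + \int[leb]_(u in `[0, t]) f u).
Proof.
move=> hf; apply: bounded_measurableD; first exact: bounded_measurable_cst.
apply: bounded_measurable_within; apply: parameterized_integral_continuous => //.
exact: bounded_measurable_integrable hf (lexx _).
Qed.

Lemma bounded_measurable_picard k :
  bounded_measurable T (picard k).1 /\ bounded_measurable T (picard k).2.
Proof.
elim: k => [|k [IH1 IH2]]; first by split; exact: bounded_measurable_cst.
rewrite /=; case: (picard k) IH1 IH2 => x y /= hx hy.
by split; apply: bounded_measurable_primitive; exact: bounded_measurable_lip.
Qed.

Let M := T * (`|b1 (x0, y0)| + `|b2 (x0, y0)|).

(** By the Lipschitz bound each step is at most [L] times the integral of the
preceding one, and [Rintegral_expR_bound] halves the constant. *)
Lemma picard_step k (t : R) : 0 <= t <= T ->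
  `|(picard k.+1).1 t - (picard k).1 t| + `|(picard k.+1).2 t - (picard k).2 t|
  <= M / 2 ^+ k * expR (L *+ 2 * t).
Proof.
have M0 : 0 <= M by rewrite mulr_ge0// addr_ge0.
elim: k t => [|k IH] t tT.
  have /andP[t0 t_T] := tT.
  rewrite /= (addrC x0) (addrC y0) !addrK !Rintegral_cst_0t//.
  rewrite !normrM (ger0_norm t0) expr0 divr1 -mulrDl mulrC.
  apply: (@le_trans _ _ M); first by rewrite /M ler_wpM2r// addr_ge0.
  rewrite ler_peMr// -[leLHS]expR0 ler_expR; apply: mulr_ge0 => //.
  by rewrite mulrn_wge0// ltW.
have /andP[t0 t_T] := tT.
have [hx hy] := bounded_measurable_picard k.
have [hx' hy'] := bounded_measurable_picard k.+1.
rewrite (picardS k.+1).1 (picardS k.+1).2 (picardS k).1 (picardS k).2.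
have cancel (a u v : R) : a + u - (a + v) = u - v by ring.
rewrite !cancel.
apply: le_trans (drift_integral_lip T t _ _ _ _ tT hx' hy' hx hy) _.
have Mk : 0 <= M / 2 ^+ k by rewrite divr_ge0// exprn_ge0.
have hphi : bounded_measurable T (fun u => `|(picard k.+1).1 u - (picard k).1 u| +
    `|(picard k.+1).2 u - (picard k).2 u|).
  by apply: bounded_measurableD; apply: bounded_measurable_norm;
    exact: bounded_measurableB.
apply: le_trans (Rintegral_expR_bound T t L (M / 2 ^+ k) _ L0 Mk tT hphi _) _.
  by move=> u /andP[u0 ut]; apply: IH; rewrite u0 (le_trans ut).
have -> : M / 2 ^+ k / 2 = M / 2 ^+ k.+1.
  by rewrite exprS; field; rewrite expf_neq0.
by rewrite ler_wpM2l ?divr_ge0 ?exprn_ge0// gerBl.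
Qed.

Lemma picard_limit : exists C x y, 0 <= C /\ forall k (t : R), 0 <= t <= T ->
  `|x t - (picard k).1 t| <= C / 2 ^+ k /\ `|y t - (picard k).2 t| <= C / 2 ^+ k.
Proof.
pose C := M * expR (L *+ 2 * T).
have M0 : 0 <= M by rewrite mulr_ge0// addr_ge0.
have step k t : 0 <= t <= T ->
    `|(picard k.+1).1 t - (picard k).1 t| + `|(picard k.+1).2 t - (picard k).2 t|
    <= C / 2 ^+ k.
  move=> tT; apply: le_trans (picard_step k t tT) _.
  rewrite /C mulrAC ler_wpM2r ?invr_ge0 ?exprn_ge0// ler_wpM2l// ler_expR.
  by rewrite ler_wpM2l ?mulrn_wge0 ?(ltW L0)//; case/andP: tT.
have ex t : exists l : R * R, 0 <= t <= T ->
    (forall k, `|l.1 - (picard k).1 t| <= C *+ 2 / 2 ^+ k) /\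
    (forall k, `|l.2 - (picard k).2 t| <= C *+ 2 / 2 ^+ k).
  have [tT|] := boolP (0 <= t <= T); last by exists (0, 0).
  have [l lP] := geometric_steps_limit (fun k => (picard k).1 t) C
    (fun k => le_trans (ler_wpDr (normr_ge0 _) (lexx _)) (step k t tT)).
  have [m mP] := geometric_steps_limit (fun k => (picard k).2 t) C
    (fun k => le_trans (ler_wpDl (normr_ge0 _) (lexx _)) (step k t tT)).
  by exists (l, m).
have [f fP] := choice ex.
exists (C *+ 2), (fun t => (f t).1), (fun t => (f t).2); split.
  by rewrite mulrn_wge0// mulr_ge0// expR_ge0.
by move=> k t tT; have [] := fP t tT.
Qed.

(** The iterates pass to the limit under the integral because the drift is
Lipschitz: the defect of the equation at the limit is at most a constant times
the distance to the [k]-th iterate, a geometric sequence in [k]. *)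
Lemma picard_lindelof : exists x y : R -> R,
  [/\ bounded_measurable T x, bounded_measurable T y &
   forall t : R, 0 <= t <= T ->
     x t = x0 + \int[leb]_(u in `[0, t]) b1 (x u, y u) /\
     y t = y0 + \int[leb]_(u in `[0, t]) b2 (x u, y u)].
Proof.
have [C [x [y [C0 xyC]]]] := picard_limit.
have cvg_of (f : R -> R) (g : nat -> R -> R) :
    (forall k, bounded_measurable T (g k)) ->
    (forall k (t : R), 0 <= t <= T -> `|f t - g k t| <= C / 2 ^+ k) ->
    bounded_measurable T f.
  move=> hg fg; split.
    apply: (measurable_fun_cvg (h := g)) => [m|t]; first by case: (hg m).
    rewrite itv_0T => tT; apply/cvgrPdist_le => e e0.
    have [k H] := geometric_eventually_le C e e0.
    by exists k => // m /= /H; apply: le_trans; exact: fg.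
  have [_ [N gN]] := hg 0%N; exists (C + N) => t tT.
  rewrite -(subrK (g 0%N t) (f t)); apply: le_trans (ler_normD _ _) _.
  by apply: lerD; [have := fg 0%N t tT; rewrite expr0 divr1|exact: gN].
have hx : bounded_measurable T x.
  apply: (cvg_of _ (fun k => (picard k).1)) => [k|k t tT].
    by case: (bounded_measurable_picard k).
  by case: (xyC k t tT).
have hy : bounded_measurable T y.
  apply: (cvg_of _ (fun k => (picard k).2)) => [k|k t tT].
    by case: (bounded_measurable_picard k).
  by case: (xyC k t tT).
exists x, y; split => // t tT.
(* The defect of the limit is compared with the exact relation between the
   iterates [k] and [k + 1]: the error is a distance to iterate [k + 1] plus the
   Lipschitz bound for the distance to iterate [k]. *)
have key k : `|x t - x0 - \int[leb]_(u in `[0, t]) b1 (x u, y u)| +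
    `|y t - y0 - \int[leb]_(u in `[0, t]) b2 (x u, y u)|
    <= (C + L * (C + C) * T + C) / 2 ^+ k.
  have [hxk hyk] := bounded_measurable_picard k.
  have := drift_integral_lip T t _ _ _ _ tT hxk hyk hx hy.
  have [] := xyC k.+1 t tT.
  rewrite (picardS k).1 (picardS k).2.
  set i1 := Rintegral _ _ _; set i2 := Rintegral _ _ _.
  set i3 := Rintegral _ _ _; set i4 := Rintegral _ _ _.
  set i5 := Rintegral _ _ _.
  have i5le : i5 <= (C + C) / 2 ^+ k * T.
    apply: (@le_trans _ _ (\int[leb]_(u in `[0, t]) ((C + C) / 2 ^+ k))).
      apply: le_Rintegral => //.
      - apply: (@bounded_measurable_integrable _ T); last by case/andP: tT.
        by apply: bounded_measurableD; apply: bounded_measurable_norm;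
          exact: bounded_measurableB.
      - apply: (@bounded_measurable_integrable _ T); last by case/andP: tT.
        exact: bounded_measurable_cst.
      - move=> u; rewrite /= in_itv/= => /andP[u0 ut].
        have uT : 0 <= u <= T by rewrite u0 (le_trans ut)//; case/andP: tT.
        have [] := xyC k u uT; rewrite (distrC (x u)) (distrC (y u)) mulrDl.
        exact: lerD.
    have /andP[t0 t_T] := tT; rewrite Rintegral_cst_0t// ler_wpM2l//.
    by rewrite divr_ge0 ?addr_ge0 ?exprn_ge0.
  have Ck : C / 2 ^+ k.+1 <= C / 2 ^+ k.
    by rewrite ler_wpM2l// lef_pV2 ?posrE ?exprn_gt0// ler_eXn2l// ltr1n.
  have := ler_normD (x t - (x0 + i1)) (i1 - i3).
  have := ler_normD (y t - (y0 + i2)) (i2 - i4).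
  have -> : x t - (x0 + i1) + (i1 - i3) = x t - x0 - i3 by ring.
  have -> : y t - (y0 + i2) + (i2 - i4) = y t - y0 - i4 by ring.
  move: i5le Ck; rewrite !mulrDl => /(ler_wpM2l (ltW L0)).
  set a := C / 2 ^+ k.
  have -> : L * (C + C) * T / 2 ^+ k = L * (a * T + a * T) by rewrite /a; ring.
  lra.
split; apply/eqP; rewrite -subr_eq0 opprD addrA; apply/eqP;
  apply: (le_geometric_eq0 _ (C + L * (C + C) * T + C)) => k; apply: le_trans (key k).
- by rewrite lerDl.
- by rewrite lerDr.
Qed.

End Picard.
End PlanarODE.

(** * The fluid equation *)

Section Primitives.
Context {R : realType}.
Notation leb := (@lebesgue_measure R).

Lemma primitive_within (T a : R) f : 0 <= T -> bounded_measurable T f ->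
  {within `[0, T], continuous (fun t => a + \int[leb]_(u in `[0, t]) f u)}.
Proof.
move=> T0 hf x; apply: cvgD; first exact: cvg_cst.
apply: parameterized_integral_continuous => //.
exact: bounded_measurable_integrable hf (lexx _).
Qed.

(** Regularity of a solution of the integral equation, by the first fundamental
theorem of calculus. *)
Lemma primitive_derivable (T a : R) f : 0 < T -> bounded_measurable T f ->
  {in `]0, T[, continuous f} ->
  let F := fun t => a + \int[leb]_(u in `[0, t]) f u in
  derivable_oo_LRcontinuous F 0 T /\
  forall t : R, 0 < t < T -> derive1 F t = f t.
Proof.
move=> T0 hf cf F.
have dF (t : R) : 0 < t < T -> derivable F t 1 /\ derive1 F t = f t.
  move=> tT; have /andP[t0 t_T] := tT.
  have [dG G'] := continuous_FTC1_closed t_T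
    (bounded_measurable_integrable T T f hf (lexx _)) t0 (cf t tT).
  split; first exact: derivableD (derivable_cst a t 1) dG.
  by rewrite derive1E (deriveD (derivable_cst a t 1) dG) derive_cst add0r -derive1E.
have /(continuous_within_itvP _ T0)[_ Fl Fr] := primitive_within T a f (ltW T0) hf.
split; last by move=> t /dF[].
by split => // t; rewrite in_itv => /dF[].
Qed.

(** The second fundamental theorem of calculus on [[0, t]].  One-sided continuity
of [F] at [t] is part of the hypothesis when [t = T], and follows from
differentiability when [t < T]. *)
Lemma derivable_integral_form (T t : R) (F f : R -> R) :
  derivable_oo_LRcontinuous F 0 T -> {within `[0, T], continuous f} ->
  (forall u : R, 0 < u < T -> derive1 F u = f u) ->
  0 <= t <= T -> F t = F 0 + \int[leb]_(u in `[0, t]) f u.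
Proof.
move=> [dF F0 FT] cf F'f /andP[]; rewrite le_eqVlt => /predU1P[<- _|t0 tT].
  by rewrite set_itv1 Rintegral_set1 addr0.
have cft : {within `[0, t], continuous f}.
  by apply: continuous_subspaceW cf; apply: subset_itvl; rewrite bnd_simp.
have sub u : 0 < u < t -> 0 < u < T.
  by move=> /andP[-> ut]; rewrite (lt_le_trans ut).
have dFt : derivable_oo_LRcontinuous F 0 t.
  split => //; first by move=> u; rewrite in_itv => /sub uT; apply: dF; rewrite in_itv.
  move: tT; rewrite le_eqVlt => /predU1P[->//|tT].
  apply: cvg_at_left_filter; apply/differentiable_continuous/derivable1_diffP.
  by apply: dF; rewrite in_itv/= t0.
have := continuous_FTC2 t0 cft dFt _.
rewrite /Rintegral => ->; first by rewrite -EFinB /= subrKC.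
by move=> u; rewrite in_itv => /sub; exact: F'f.
Qed.

End Primitives.

Section Fluid.
Context {R : realType}.
Notation leb := (@lebesgue_measure R).

Lemma minr_lip (a b a' b' : R) :
  `|Num.min a b - Num.min a' b'| <= `|a - a'| + `|b - b'|.
Proof.
have := ler_norm (a - a'); have := ler_norm (a' - a).
have := ler_norm (b - b'); have := ler_norm (b' - b).
rewrite (distrC a' a) (distrC b' b) => H1 H2 H3 H4.
by rewrite ler_norml; case: (lerP a b); case: (lerP a' b'); lra.
Qed.

Lemma maxr0_lip (a b a' b' : R) :
  `|Num.max (a - b) 0 - Num.max (a' - b') 0| <= `|a - a'| + `|b - b'|.
Proof.
have := ler_norm (a - a'); have := ler_norm (a' - a).
have := ler_norm (b - b'); have := ler_norm (b' - b).
rewrite (distrC a' a) (distrC b' b) => H1 H2 H3 H4.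
by rewrite ler_norml; case: (lerP (a - b) 0); case: (lerP (a' - b') 0); lra.
Qed.

Variables (lambda mu theta gamma p : R) (c : nat).

Definition drift_q (z : R * R) : R :=
  lambda - mu * Num.min z.1 z.2 - theta * Num.max (z.1 - z.2) 0.

Definition drift_s (z : R * R) : R :=
  gamma * (c%:R - z.2) - p * mu * Num.min z.1 z.2.

(** The minimum contributes [mu] to each of the two drifts, since [p <= 1]. *)
Definition drift_lip := mu *+ 2 + theta + gamma.

Hypotheses (mu0 : 0 < mu) (theta0 : 0 < theta) (gamma0 : 0 < gamma).
Hypothesis p01 : 0 <= p <= 1.

Lemma drift_lip_gt0 : 0 < drift_lip.
Proof. by rewrite /drift_lip !addr_gt0// mulrn_wgt0. Qed.

Lemma drift_lipP z z' :
  `|drift_q z - drift_q z'| + `|drift_s z - drift_s z'|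
  <= drift_lip * (`|z.1 - z'.1| + `|z.2 - z'.2|).
Proof.
case: z z' => [a b] [a' b']; rewrite /drift_q /drift_s /drift_lip /=.
have := minr_lip a b a' b'; have := maxr0_lip a b a' b'.
set m := Num.min a b; set m' := Num.min a' b'.
set x := Num.max _ _; set x' := Num.max _ _ => Hx Hm.
have -> : lambda - mu * m - theta * x - (lambda - mu * m' - theta * x') =
   - (mu * (m - m')) - theta * (x - x') by ring.
have -> : gamma * (c%:R - b) - p * mu * m - (gamma * (c%:R - b') - p * mu * m') =
   - (gamma * (b - b')) - p * (mu * (m - m')) by ring.
have H1 := ler_normB (- (mu * (m - m'))) (theta * (x - x')).
have H2 := ler_normB (- (gamma * (b - b'))) (p * (mu * (m - m'))).
move: H1 H2; rewrite !normrN !normrM (gtr0_norm mu0) (gtr0_norm theta0) (gtr0_norm gamma0).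
case/andP: p01 => p0 p1.
rewrite (ger0_norm p0) => H1 H2.
have Hmm : mu * `|m - m'| <= mu * (`|a - a'| + `|b - b'|) by rewrite ler_pM2l.
have Hxx : theta * `|x - x'| <= theta * (`|a - a'| + `|b - b'|) by rewrite ler_pM2l.
have Hbb : gamma * `|b - b'| <= gamma * (`|a - a'| + `|b - b'|).
  by rewrite ler_pM2l// lerDr.
have Hp : p * (mu * `|m - m'|) <= mu * `|m - m'|.
  by rewrite ler_piMl// mulr_ge0// ltW.
by rewrite mulr2n !mulrDl; lra.
Qed.

Lemma measurable_drift_q : measurable_fun setT drift_q.
Proof.
apply: measurable_funB; first apply: measurable_funB.
- exact: measurable_cst.
- apply: measurable_funM; first exact: measurable_cst.
  by apply: measurable_minr; [exact: measurable_fst|exact: measurable_snd].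
- apply: measurable_funM; first exact: measurable_cst.
  apply: measurable_maxr; last exact: measurable_cst.
  by apply: measurable_funB; [exact: measurable_fst|exact: measurable_snd].
Qed.

Lemma measurable_drift_s : measurable_fun setT drift_s.
Proof.
apply: measurable_funB; (apply: measurable_funM; first exact: measurable_cst).
- apply: measurable_funB; first exact: measurable_cst.
  exact: measurable_snd.
- by apply: measurable_minr; [exact: measurable_fst|exact: measurable_snd].
Qed.

Lemma drift_q_lip z z' : `|drift_q z - drift_q z'|
  <= drift_lip * (`|z.1 - z'.1| + `|z.2 - z'.2|).
Proof. by apply: le_trans (drift_lipP z z'); rewrite lerDl. Qed.

Lemma drift_s_lip z z' : `|drift_s z - drift_s z'|
  <= drift_lip * (`|z.1 - z'.1| + `|z.2 - z'.2|).
Proof. by apply: le_trans (drift_lipP z z'); rewrite lerDr. Qed.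

(** The form of the fluid equation that makes sense for paths with jumps, and in
which the scaled processes are compared with its solution. *)
Definition fluid_integral (q0 s0 T : R) (q s : R -> R) : Prop :=
  [/\ bounded_measurable T q, bounded_measurable T s &
   forall t : R, 0 <= t <= T ->
     q t = q0 + \int[leb]_(u in `[0, t]) drift_q (q u, s u) /\
     s t = s0 + \int[leb]_(u in `[0, t]) drift_s (q u, s u)].

Lemma fluid_solution_integral (q0 s0 T : R) q s : 0 < T ->
  fluid_solution lambda mu theta gamma p c q0 s0 T q s ->
  fluid_integral q0 s0 T q s.
Proof.
move=> T0 [[q00 s00] dq ds eqs].
have cq := derivable_oo_LRcontinuous_within dq.
have cs := derivable_oo_LRcontinuous_within ds.
split; try exact: bounded_measurable_within.
have /(continuous_within_itvP _ T0)[cqi cql cqr] := cq.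
have /(continuous_within_itvP _ T0)[csi csl csr] := cs.
have cdrift (b : R * R -> R) :
    (forall z z', `|b z - b z'| <= drift_lip * (`|z.1 - z'.1| + `|z.2 - z'.2|)) ->
    {within `[0, T], continuous (fun u => b (q u, s u))}.
  move=> lip; apply/(continuous_within_itvP _ T0); split.
  - move=> u uT; apply: (cvg_lip _ drift_lip_gt0 _ _ _ _ _ _ _ lip); [exact: cqi|exact: csi].
  - apply: (cvg_lip _ drift_lip_gt0 _ _ _ _ _ _ _ lip); [exact: cql|exact: csl].
  - apply: (cvg_lip _ drift_lip_gt0 _ _ _ _ _ _ _ lip); [exact: cqr|exact: csr].
move=> t tT; rewrite -q00 -s00; split.
- apply: derivable_integral_form dq _ _ tT; first exact: cdrift drift_q_lip.
  by move=> u /eqs[].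
- apply: derivable_integral_form ds _ _ tT; first exact: cdrift drift_s_lip.
  by move=> u /eqs[].
Qed.

(** The solution of the integral equation is only determined on [[0, T]], whereas
a two-sided derivative is required inside.  The solution returned is
therefore the primitive itself, which agrees with the Picard limit on
[[0, T]]. *)
Lemma fluid_exists (q0 s0 T : R) : 0 < T ->
  exists q s, fluid_solution lambda mu theta gamma p c q0 s0 T q s.
Proof.
move=> T0.
have [x [y [hx hy xy]]] := picard_lindelof drift_q drift_s drift_lip drift_lip_gt0
  drift_lipP measurable_drift_q measurable_drift_s T q0 s0 (ltW T0).
have hb1 := bounded_measurable_lip drift_lip drift_lip_gt0 _ T x y
  measurable_drift_q drift_q_lip hx hy.
have hb2 := bounded_measurable_lip drift_lip drift_lip_gt0 _ T x y
  measurable_drift_s drift_s_lip hx hy.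
pose q t := q0 + \int[leb]_(u in `[0, t]) drift_q (x u, y u).
pose s t := s0 + \int[leb]_(u in `[0, t]) drift_s (x u, y u).
have xq (t : R) : 0 <= t <= T -> x t = q t by move=> /xy[].
have ys (t : R) : 0 <= t <= T -> y t = s t by move=> /xy[].
have wc (f g : R -> R) : {within `[0, T], continuous g} ->
    (forall t : R, 0 <= t <= T -> f t = g t) -> {in `]0, T[, continuous f}.
  move=> cg fg; have : {within `[0, T], continuous f}.
    by apply: subspace_eq_continuous cg => t; rewrite inE itv_0T => /fg.
  by case/(continuous_within_itvP _ T0).
have cx := wc _ _ (primitive_within T q0 _ (ltW T0) hb1) xq.
have cy := wc _ _ (primitive_within T s0 _ (ltW T0) hb2) ys.
have [] := primitive_derivable T q0 _ T0 hb1.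
  by move=> t tT; apply: (cvg_lip _ drift_lip_gt0 _ _ _ _ _ _ _ drift_q_lip); [exact: cx|exact: cy].
rewrite -/q => dq q'.
have [] := primitive_derivable T s0 _ T0 hb2.
  by move=> t tT; apply: (cvg_lip _ drift_lip_gt0 _ _ _ _ _ _ _ drift_s_lip); [exact: cx|exact: cy].
rewrite -/s => ds s'.
exists q, s; split => //.
  by rewrite /q /s set_itv1 !Rintegral_set1 !addr0.
move=> t /[dup] tT /andP[t0 t_T].
have t0T : 0 <= t <= T by rewrite !ltW.
by rewrite q'// s'// xq// ys.
Qed.

Lemma fluid_unique (q0 s0 T : R) q s q' s' :
  fluid_integral q0 s0 T q s -> fluid_integral q0 s0 T q' s' ->
  forall t : R, 0 <= t <= T -> q' t = q t /\ s' t = s t.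
Proof.
move=> [hq hs qs] [hq' hs' qs'] t tT.
have := ode_stability drift_q drift_s drift_lip drift_lip_gt0 drift_lipP
  measurable_drift_q measurable_drift_s T 0 q' s' q s hq' hs' hq hs _ t tT.
have cancel (a u v : R) : a + u - (a + v) - (u - v) = 0 by ring.
rewrite mul0rn mul0r => H; have {}H : `|q' t - q t| + `|s' t - s t| <= 0.
  apply: H => u uT; have [-> ->] := qs _ uT; have [-> ->] := qs' _ uT.
  by rewrite !cancel normr0 addr0.
have := normr_ge0 (q' t - q t); have := normr_ge0 (s' t - s t) => H1 H2.
by split; apply/eqP; rewrite -subr_eq0 -normr_le0; lra.
Qed.

End Fluid.

(** * Right-constant paths and events of probability tending to one *)

Section Paths.
Context {R : realType}.

(** From each time the path stays in [Y] up to some later rational [r], so the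
set is the union over the rationals [r] of the times from which it stays in [Y]
until [r]; each of these is an interval. *)
Lemma measurable_right_constant (U : Type) (f : R -> U) (Y : set U) :
  (forall t : R, 0 <= t -> \forall u \near t^'+, f u = f t) ->
  measurable [set t : R | 0 <= t /\ Y (f t)].
Proof.
move=> fr.
pose I (r : rat) := [set u : R | 0 <= u < ratr r /\
  forall v : R, u <= v < ratr r -> Y (f v)].
have -> : [set t : R | 0 <= t /\ Y (f t)] = \bigcup_r I r.
  apply/seteqP; split=> [t [t0 Yt]|t [r _ [/andP[t0 tr] It]]].
    have [e /= e0 he] := fr t t0.
    have [r] := @rat_in_itvoo R t (t + e) (ltr_pwDr e0 (lexx _)).
    rewrite in_itv/= => /andP[tr re]; exists r => //; split; first by rewrite t0.
    move=> v /andP[]; rewrite le_eqVlt => /predU1P[<-//|tv] vr.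
    rewrite he//= ltr0_norm ?subr_lt0// opprB ltrBlDl; exact: lt_trans re.
  by split=> //; apply: It; rewrite lexx.
apply: bigcupT_measurable_rat => r; apply: is_interval_measurable.
move=> x y [/andP[x0 xr] Ix] [/andP[y0 yr] Iy] z /andP[xz zy]; split.
  by rewrite (le_trans x0 xz) (le_lt_trans zy yr).
by move=> v /andP[zv vr]; apply: Ix; rewrite (le_trans xz zv).
Qed.

Lemma measurable_fun_right_constant (U : Type) (T : R) (f : R -> U) (g : U -> R) :
  (forall t : R, 0 <= t -> \forall u \near t^'+, f u = f t) ->
  measurable_fun `[0, T] (fun t => g (f t)).
Proof.
move=> fr _ Y mY.
have -> : `[0, T] `&` (fun t => g (f t)) @^-1` Y =
    `[0, T] `&` [set t : R | 0 <= t /\ (g @^-1` Y) (f t)].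
  apply/seteqP; split=> t /=; rewrite in_itv/=.
    by move=> [/andP[t0 tT] Yt]; rewrite t0.
  by move=> [tT [_ Yt]].
by apply: measurableI => //; exact: measurable_right_constant.
Qed.

End Paths.

Section WithHighProbability.
Context {d : measure_display} {Omega : measurableType d} {R : realType}.
Variable P : probability Omega R.

Lemma measurable_nat_rel (X Y : Omega -> nat) (A : nat -> nat -> Prop) :
  measurable_fun setT X -> measurable_fun setT Y ->
  measurable [set w | A (X w) (Y w)].
Proof.
move=> mX mY.
have -> : [set w | A (X w) (Y w)] =
    \bigcup_(i in setT) \bigcup_(j in [set j | A i j])
      ((X @^-1` [set i]) `&` (Y @^-1` [set j])).
  apply/seteqP; split=> w /=; first by move=> Aw; exists (X w) => //; exists (Y w).
  by move=> [i _ [j Aij [/= -> ->]]].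
apply: bigcup_measurable => i _; apply: bigcup_measurable => j _.
apply: measurableI; rewrite -[_ @^-1` _]setTI; [exact: mX|exact: mY].
Qed.

(** [G n] holds with probability tending to one.  The complement of [G n] is only
asked to lie in a small measurable set, because the events of interest quantify
over uncountably many times and hold outside null sets that need not be
measurable. *)
Definition whp (G : nat -> set Omega) : Prop :=
  forall e : R, 0 < e -> \forall n \near \oo,
    exists B, [/\ measurable B, (P B <= e%:E)%E & ~` B `<=` G n].

Lemma whp_imp (G H : nat -> set Omega) :
  (\forall n \near \oo, G n `<=` H n) -> whp G -> whp H.
Proof.
move=> GH hG e e0; move: (hG e e0); apply: filterS2 GH => n GHn [B [mB PB BG]].
by exists B; split => // w /BG /GHn.
Qed.

Lemma whp_and (G H : nat -> set Omega) :
  whp G -> whp H -> whp (fun n => G n `&` H n).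
Proof.
move=> hG hH e e0; have e20 : 0 < e / 2 by rewrite divr_gt0.
move: (hG _ e20) (hH _ e20); apply: filterS2 => n [B [mB PB BG]] [C [mC PC CH]].
exists (B `|` C); split; first exact: measurableU.
  apply: le_trans (measureU2 P mB mC) _.
  by rewrite [e in leRHS]splitr EFinD leeD.
by rewrite setCU => w [/BG ? /CH ?].
Qed.

Lemma whp_ae (G : nat -> set Omega) :
  (forall n, (0 < n)%N -> {ae P, forall w, G n w}) -> whp G.
Proof.
move=> hG e e0; exists 1%N => // n /= /hG [B [mB PB GB]]; exists B; split=> //.
  by rewrite PB lee_fin ltW.
by move=> w Bw; apply: contrapT => Gw; apply: Bw; exact: GB.
Qed.

Lemma whp_forall (m : nat) (G : nat -> nat -> set Omega) :
  (forall j, (j < m)%N -> whp (G j)) ->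
  whp (fun n => [set w | forall j, (j < m)%N -> G j n w]).
Proof.
elim: m => [_|m IH hG].
  by apply: whp_ae => n _; exact: aeW.
have h1 := IH (fun j jm => hG j (ltnW jm)).
apply: whp_imp (whp_and _ _ h1 (hG m (ltnSn m))); apply: nearW => n w [/= H1 H2] j.
by rewrite ltnS leq_eqVlt => /predU1P[->//|/H1].
Qed.

Lemma whp_measure_cvg0 (G A : nat -> set Omega) : whp G ->
  (\forall n \near \oo, measurable (A n) /\ A n `<=` ~` G n) ->
  P (A n) @[n --> \oo] --> 0%E.
Proof.
move=> hG hA; apply/fine_cvgP; split.
  by apply: filterS hA => n [mA _]; exact: fin_num_measure.
apply/cvgrPdist_le => e e0; move: (hG e e0) hA; apply: filterS2 => n.
move=> [B [mB PB BG]] [mA AG] /=.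
rewrite sub0r normrN ger0_norm ?fine_ge0//.
rewrite -lee_fin fineK ?fin_num_measure//; apply: le_trans PB.
apply: le_measure; rewrite ?inE// => w /AG Gw; apply: contrapT => /BG; exact: Gw.
Qed.

Lemma whp_bound (G : nat -> set Omega) (b : nat -> R) :
  (\forall n \near \oo, measurable (~` G n) /\ (P (~` G n) <= (b n)%:E)%E) ->
  b @ \oo --> 0 -> whp G.
Proof.
move=> hG /cvgrPdist_le b0 e e0; move: (b0 e e0) hG; apply: filterS2 => n.
rewrite sub0r normrN => bn [mG PG]; exists (~` G n); split => //; last by rewrite setCK.
by apply: le_trans PG _; rewrite lee_fin (le_trans (ler_norm _) bn).
Qed.

(** A nondecreasing function caught near a linear one at all points of a grid is
caught between the grid points as well, up to the increase of the linear
function over one mesh.  Finitely many grid points suffice, so pointwise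
convergence in probability becomes uniform. *)
Lemma whp_monotone_uniform (V : R -> Omega -> R) (a : R) : 0 <= a ->
  {ae P, forall w, forall s t : R, 0 <= s -> s <= t -> V s w <= V t w} ->
  (forall x e : R, 0 <= x -> 0 < e ->
    whp (fun n => [set w | `|V (n%:R * x) w / n%:R - a * x| <= e])) ->
  forall K e : R, 0 < K -> 0 < e ->
    whp (fun n => [set w | forall x, 0 <= x <= K ->
      `|V (n%:R * x) w / n%:R - a * x| <= e]).
Proof.
move=> a0 monoV hV K e K0 e0.
have [m _ /(_ m (leqnn m)) /= hm] := nbhs_infty_gtr (Num.max 0 (a * K / (e / 2))).
move: hm; rewrite gt_max => /andP[m0 hm].
have e20 : 0 < e / 2 by rewrite divr_gt0.
pose x j : R := K * j%:R / m%:R.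
have x0 j : 0 <= x j by rewrite /x divr_ge0// mulr_ge0// ltW.
have xS j : x j.+1 = x j + K / m%:R.
  by rewrite /x -[in LHS]natr1; field; rewrite gt_eqF.
have small : a * (K / m%:R) <= e / 2.
  by rewrite mulrA ler_pdivrMr// -ler_pdivrMl// mulrC ltW.
(* The grid has one point beyond [K], so that every point of [[0, K]] has a
   right neighbour in it. *)
have := whp_and _ _ (whp_ae (fun=> _) (fun _ _ => monoV))
  (whp_forall m.+2 _ (fun j _ => hV (x j) (e / 2) (x0 j) e20)).
apply: whp_imp; exists 1%N => // n /= n0 w [mono grid] y /andP[y0 yK].
have n0' : 0 < n%:R :> R by rewrite ltr0n.
have ym0 : 0 <= y * m%:R / K by rewrite divr_ge0 ?mulr_ge0// ltW.
have := truncn_itv ym0; set j := Num.truncn _ => /andP[jy yj].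
have xjy : x j <= y.
  by rewrite /x ler_pdivrMr// mulrC -ler_pdivlMr.
have yxj : y <= x j.+1.
  by rewrite /x ler_pdivlMr// -ler_pdivrMl// mulrC ltW.
have jm : (j <= m)%N.
  rewrite -(ler_nat R); apply: le_trans jy _.
  by rewrite ler_pdivrMr// mulrC ler_pM2l.
have := grid j (leqW jm); have := grid j.+1 jm.
have lo := mono (n%:R * x j) (n%:R * y) (mulr_ge0 (ltW n0') (x0 j)) _.
have hi := mono (n%:R * y) (n%:R * x j.+1) (mulr_ge0 (ltW n0') y0) _.
move: lo hi; rewrite !ler_pM2l// => /(_ xjy) lo /(_ yxj) hi.
have {}lo : V (n%:R * x j) w / n%:R <= V (n%:R * y) w / n%:R.
  by rewrite ler_pM2r// invr_gt0.
have {}hi : V (n%:R * y) w / n%:R <= V (n%:R * x j.+1) w / n%:R.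
  by rewrite ler_pM2r// invr_gt0.
have ax : a * x j <= a * y by rewrite ler_wpM2l.
have ay : a * y <= a * x j.+1 by rewrite ler_wpM2l.
have axS : a * x j.+1 = a * x j + a * (K / m%:R) by rewrite xS mulrDr.
by rewrite !ler_norml; lra.
Qed.

End WithHighProbability.

(** * Law of large numbers for a Poisson process *)

Lemma cvg_inv_natr {R : realType} : (n%:R^-1 : R) @[n --> \oo] --> (0 : R).
Proof. by rewrite -cvg_shiftS; exact: cvg_harmonic. Qed.

Section Poisson.
Context {d : measure_display} {Omega : measurableType d} {R : realType}.
Variable P : probability Omega R.

(** Since [k * t^k / k! = t * t^(k-1) / (k-1)!], the sum collapses to the sum of
the weights and one boundary term, which is nonpositive for [0 < t <= m]. *)
Lemma poisson_sum_sq (t : R) (m : nat) :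
  \sum_(0 <= k < m) (k%:R - t) ^+ 2 * (t ^+ k / k`!%:R) =
  t * (\sum_(0 <= k < m) t ^+ k / k`!%:R) + m%:R * (t - m%:R) * (t ^+ m / m`!%:R).
Proof.
elim: m => [|m IH]; first by rewrite !big_geq// mulr0 !mul0r addr0.
rewrite !big_nat_recr//= IH factS natrM (exprS t).
have m1 : m.+1%:R != 0 :> R by rewrite pnatr_eq0.
have mf : m`!%:R != 0 :> R by rewrite pnatr_eq0 -lt0n fact_gt0.
by rewrite -!natr1 in m1 *; field; rewrite mf.
Qed.

(** The variance of the Poisson law bounds every partial sum: the partial sums
increase, and as soon as [m >= t] the boundary term of [poisson_sum_sq] is
nonpositive. *)
Lemma poisson_sum_sq_le (t : R) (m : nat) : 0 < t ->
  \sum_(0 <= k < m) (k%:R - t) ^+ 2 * poisson_pmf t k <= t.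
Proof.
move=> t0.
have a0 k : 0 <= t ^+ k / k`!%:R by rewrite divr_ge0// exprn_ge0// ltW.
have -> : \sum_(0 <= k < m) (k%:R - t) ^+ 2 * poisson_pmf t k =
   (\sum_(0 <= k < m) (k%:R - t) ^+ 2 * (t ^+ k / k`!%:R)) * expR (- t).
  by rewrite mulr_suml; apply: eq_bigr => k _; rewrite /poisson_pmf t0 mulrA.
rewrite expRN ler_pdivrMr ?expR_gt0//.
have [M _ /(_ M (leqnn M)) /= tM] := nbhs_infty_gtr t.
have mono : {homo (fun m => \sum_(0 <= k < m) (k%:R - t) ^+ 2 * (t ^+ k / k`!%:R)) :
    m n / (m <= n)%N >-> m <= n}.
  apply/nondecreasing_seqP => k; rewrite big_nat_recr//= lerDl.
  by rewrite mulr_ge0// sqr_ge0.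
apply: le_trans (mono _ _ (leq_maxl m M)) _ => /=.
rewrite poisson_sum_sq.
set m' := maxn m M.
have tm' : t <= m'%:R by apply: le_trans (ltW tM) _; rewrite ler_nat leq_maxr.
apply: (@le_trans _ _ (t * (\sum_(0 <= k < m') t ^+ k / k`!%:R))).
  by rewrite gerDl mulr_le0_ge0// mulr_ge0_le0// subr_le0.
rewrite ler_pM2l//.
have := @nondecreasing_cvgn_le R (series (exp_coeff t)) _ (is_cvg_series_exp_coeff t) m'.
apply; apply/nondecreasing_seqP => k.
by rewrite /series/= big_nat_recr//= lerDl; exact: a0.
Qed.

(** Chebyshev's inequality, carried out on the probability mass function. *)
Lemma poisson_tail (D : Omega -> nat) (t r : R) : 0 < t -> 0 < r ->
  measurable_fun setT D ->
  (forall k, P [set w | D w = k] = (poisson_pmf t k)%:E) ->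
  (P [set w | (r <= `|(D w)%:R - t|)%R] <= (t / r ^+ 2)%:E)%E.
Proof.
move=> t0 r0 mD DP.
pose F : set nat := [set k | r <= `|k%:R - t|].
have -> : [set w | r <= `|(D w)%:R - t|] = \bigcup_(k in F) [set w | D w = k].
  by apply/seteqP; split=> w /= => [H|[k Fk ->]//]; exists (D w).
rewrite measure_bigcup; last 2 first.
- move=> k _; have -> : [set w | D w = k] = D @^-1` [set k] by [].
  by rewrite -[_ @^-1` _]setTI; exact: mD.
- by move=> i j _ _ [w [/= <- <-]].
rewrite (eq_eseriesr (g := fun k => (poisson_pmf t k)%:E)); last first.
  by move=> k _; exact: DP.
apply: lime_le.
  by apply: is_cvg_nneseries_cond => n _ _; rewrite lee_fin poisson_pmf_ge0.
apply: nearW => m; rewrite sumEFin lee_fin ler_pdivlMr ?exprn_gt0//.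
apply: le_trans (poisson_sum_sq_le t m t0).
rewrite mulr_suml big_mkcond/=; apply: ler_sum => k _.
case: ifPn; rewrite ?inE; last by rewrite mulr_ge0 ?sqr_ge0 ?poisson_pmf_ge0.
move=> Fk; rewrite mulrC ler_wpM2r ?poisson_pmf_ge0//.
by rewrite -[leRHS]real_normK ?num_real// ler_pXn2r// nnegrE ltW.
Qed.

(** The law of [N t] is known through the increment [N t - N 0], and [N 0 = 0]
almost surely.  The limit [1 * x] has the shape of the limit in
[whp_monotone_uniform]. *)
Lemma poisson_lln (N : R -> Omega -> nat) (x e : R) : unit_poisson_process P N ->
  0 <= x -> 0 < e ->
  whp P (fun n => [set w | `|(N (n%:R * x) w)%:R / n%:R - 1 * x| <= e]).
Proof.
move=> [mN paths incr _] + e0.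
have N0 : {ae P, forall w, N 0 w = 0%N}.
  by apply: filterS paths => w [].
rewrite le_eqVlt => /predU1P[<-|x0].
  apply: whp_imp (whp_ae P (fun=> _) (fun _ _ => N0)); apply: nearW => n w /= Nw.
  by rewrite mulr0 mulr0 Nw mul0r subrr normr0 ltW.
pose D (y : R) w := (N y w - N 0%R w)%N.
have mdiff (y : R) : 0 <= y -> measurable_fun setT (D y).
  by move=> y0; apply: measurable_fun_subn; exact: mN.
pose G n := [set w | `|(D (n%:R * x) w)%:R / n%:R - x| < e].
have hG : whp P G.
  apply: (whp_bound P _ (fun n => x / e ^+ 2 * n%:R^-1)).
    exists 1%N => // n /= n0; have n0' : 0 < n%:R :> R by rewrite ltr0n.
    have nx0 : 0 < n%:R * x by rewrite mulr_gt0.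
    have -> : ~` G n = [set w | n%:R * e <= `|(D (n%:R * x) w)%:R - n%:R * x|].
      apply/seteqP; split=> w /=.
        move/negP; rewrite -leNgt => /(ler_wpM2l (ltW n0')).
        rewrite -[X in _ <= X * _ -> _](ger0_norm (ltW n0')) -normrM mulrBr.
        by rewrite mulrCA divff ?mulr1// gt_eqF.
      move=> H; apply/negP; rewrite -leNgt -(ler_pM2l n0'); apply: le_trans H _.
      rewrite -[X in _ <= X * _](ger0_norm (ltW n0')) -normrM mulrBr.
      by rewrite mulrCA divff ?mulr1// gt_eqF.
    split.
      have := measurable_nat_rel (D (n%:R * x)) (fun=> 0%N)
        (fun i _ => n%:R * e <= `|i%:R - n%:R * x|).
      by apply; [exact/mdiff/ltW|exact: measurable_cst].
    apply: le_trans (poisson_tail _ _ _ nx0 (mulr_gt0 n0' e0) (mdiff _ (ltW nx0)) _) _.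
      by move=> k; rewrite [LHS]incr// subr0.
    rewrite lee_fin le_eqVlt; apply/orP; left; apply/eqP; field.
    by rewrite !gt_eqF.
  rewrite -(mulr0 (x / e ^+ 2)); apply: cvgM; first exact: cvg_cst.
  exact: cvg_inv_natr.
apply: whp_imp (whp_and _ _ _ hG (whp_ae P (fun=> _) (fun _ _ => N0))); apply: nearW => n w [/= H Nw].
by move: H; rewrite /G /D /= Nw subn0 mul1r => /ltW.
Qed.

Lemma poisson_flln (N : R -> Omega -> nat) (K e : R) : unit_poisson_process P N ->
  0 < K -> 0 < e ->
  whp P (fun n => [set w | forall x, 0 <= x <= K ->
    `|(N (n%:R * x) w)%:R / n%:R - x| <= e]).
Proof.
move=> hN K0 e0.
have := whp_monotone_uniform P (fun t w => (N t w)%:R) 1 ler01.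
move=> /(_ _ (fun x e => poisson_lln N x e hN)).
have mono : {ae P, forall w, forall s t : R, 0 <= s -> s <= t ->
    (N s w)%:R <= (N t w)%:R :> R}.
  apply: filterS (pp_paths hN) => w [_ H _] s t s0 st.
  by rewrite ler_nat H.
move=> /(_ mono K e K0 e0); apply: whp_imp; apply: nearW => n w /= H x xK.
by have := H x xK; rewrite mul1r.
Qed.

End Poisson.

(** * Second moments of Bernoulli sums *)

Section Bernoulli.
Context {d : measure_display} {Omega : measurableType d} {R : realType}.
Variable P : probability Omega R.

Lemma prob_bounded_integrable (f : Omega -> R) (M : R) : measurable_fun setT f ->
  (forall w, `|f w| <= M) -> P.-integrable setT (EFin \o f).
Proof.
move=> mf fM; apply: measurable_bounded_integrable => //.
  by rewrite [ltLHS]probability_setT ltry.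
exists M; split; first exact: num_real.
by move=> x Mx w _; exact: le_trans (fM w) (ltW Mx).
Qed.

Lemma Rintegral_sum (I : Type) (s : seq I) (f : I -> Omega -> R) :
  (forall i, P.-integrable setT (EFin \o f i)) ->
  \int[P]_w (\sum_(i <- s) f i w) = \sum_(i <- s) \int[P]_w f i w.
Proof.
move=> hf; rewrite /Rintegral.
under eq_integral do rewrite -sumEFin.
rewrite (integral_sum _ (f := fun i => EFin \o f i))//.
rewrite (eq_bigr (fun i => (\int[P]_w f i w)%:E)) ?sumEFin// => i _.
by rewrite /Rintegral fineK//; apply: integrable_fin_num => //; exact: hf.
Qed.

Lemma markov_bounded (f : Omega -> R) (M a : R) (B : set Omega) :
  measurable_fun setT f -> (forall w, 0 <= f w <= M) -> 0 <= a ->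
  measurable B -> (forall w, B w -> a <= f w) ->
  a * fine (P B) <= \int[P]_w f w.
Proof.
move=> mf fM a0 mB aB.
have i1 : P.-integrable setT (EFin \o (\1_B : Omega -> R)).
  apply: (prob_bounded_integrable _ 1); first exact: measurable_indic.
  by move=> w; rewrite indicE; case: (_ \in _); rewrite ?normr1 ?normr0.
have -> : a * fine (P B) = \int[P]_w (a * \1_B w).
  by rewrite RintegralZl// /Rintegral integral_indic// setIT.
apply: le_Rintegral => //.
- by have := integrableZl measurableT a i1; apply: eq_integrable => // w _.
- apply: (prob_bounded_integrable _ M) => // w.
  by have /andP[f0 ?] := fM w; rewrite ger0_norm.
- move=> w _; rewrite indicE; case: (boolP (w \in _)) => [|_].
    by rewrite inE mulr1 => /aB.
  by rewrite mulr0; case/andP: (fM w).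
Qed.

Lemma chebyshev_sq (f : Omega -> R) (M r v : R) : measurable_fun setT f ->
  (forall w, `|f w| <= M) -> 0 < r -> \int[P]_w (f w ^+ 2) <= v ->
  (P [set w | (r <= `|f w|)%R] <= (v / r ^+ 2)%:E)%E.
Proof.
move=> mf fM r0 fv.
have mA : measurable [set w | r <= `|f w|].
  rewrite -[X in measurable X]setTI.
  by apply: (measurable_fun_le (f := fun=> r)) => //; exact: measurableT_comp.
have M0 : 0 <= M by apply: le_trans (fM point).
rewrite -[P _]fineK ?fin_num_measure// lee_fin ler_pdivlMr ?exprn_gt0//.
rewrite mulrC; apply: le_trans fv.
apply: (markov_bounded _ (M ^+ 2)) => //.
- exact: measurable_funX.
- move=> w; apply/andP; split; first exact: sqr_ge0.
  rewrite -[leLHS]real_normK ?num_real//.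
  by rewrite ler_pXn2r// nnegrE.
- exact: sqr_ge0.
- move=> w /= rf; rewrite -[leRHS]real_normK ?num_real//.
  by rewrite ler_pXn2r// nnegrE ltW.
Qed.

Variables (p : R) (xi : nat -> Omega -> bool).
Hypothesis p01 : 0 <= p <= 1.
Hypothesis hxi : iid_bernoulli P p xi.

Let A i := xi i @^-1` [set true].

Let mA i : measurable (A i).
Proof. by have [mxi _ _] := hxi; rewrite -[A i]setTI; exact: mxi. Qed.

Let PA i : P (A i) = p%:E.
Proof. by have [_ + _] := hxi; move=> /(_ i true). Qed.

Let PAA i j : i != j -> P (A i `&` A j) = (p * p)%:E.
Proof.
move=> ij; have [_ _ indep] := hxi.
have := indep [fset i; j]%fset A.
rewrite big_fsetU1 ?inE//= big_seq_fset1 !PA -EFinM.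
have -> : \bigcap_(k in [set` [fset i; j]%fset]) A k = A i `&` A j.
  apply/seteqP; split=> w.
    by move=> H; split; apply: H; rewrite /= !inE eqxx ?orbT.
  by move=> [Ai Aj] k; rewrite /= !inE => /orP[]/eqP->.
apply=> k _; exists [set true] => //; by rewrite setTI.
Qed.

Let Z i w : R := (xi i w)%:R - p.

Let ZE i w : Z i w = \1_(A i) w - p.
Proof.
rewrite /Z indicE; congr (_%:R - _).
by case E : (xi i w); [rewrite mem_set|rewrite memNset// /A /= E].
Qed.

Let mZ i : measurable_fun setT (Z i).
Proof.
apply: (eq_measurable_fun (fun w => \1_(A i) w - p)); first by move=> w _; rewrite ZE.
by apply: measurable_funB; [exact: measurable_indic|exact: measurable_cst].
Qed.

Let Z1 i w : `|Z i w| <= 1.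
Proof.
by case/andP: p01 => p0 p1; rewrite /Z ler_norml; case: (xi i w) => /=; lra.
Qed.

Let iZZ i j : P.-integrable setT (EFin \o (fun w => Z i w * Z j w)).
Proof.
apply: (prob_bounded_integrable _ 1); first exact: measurable_funM.
by move=> w; rewrite normrM mulr_ile1.
Qed.

Let EZZ i j : \int[P]_w (Z i w * Z j w) <= (i == j)%:R.
Proof.
have [_|ij] := eqVneq i j.
  apply: (@le_trans _ _ (\int[P]_w 1)).
    apply: le_Rintegral => //.
      by apply: (prob_bounded_integrable _ 1) => // w; rewrite normr1.
    by move=> w _; rewrite (le_trans (ler_norm _))// normrM mulr_ile1.
  by rewrite Rintegral_cst// mul1r [X in fine X]probability_setT.
have i1 B : measurable B -> P.-integrable setT (EFin \o (\1_B : Omega -> R)).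
  move=> mB; apply: (prob_bounded_integrable _ 1); first exact: measurable_indic.
  by move=> w; rewrite indicE; case: (_ \in _); rewrite ?normr1 ?normr0.
have E1 B : measurable B -> \int[P]_w (\1_B w) = fine (P B).
  by move=> mB; rewrite /Rintegral integral_indic// setIT.
(* The product of two centred variables as a linear combination of
   indicators, whose means are known. *)
pose a := [tuple 1; - p; - p; p * p].
pose B := [tuple A i `&` A j; A i; A j; setT].
have mB k : measurable (tnth B k).
  case: k; do 4?[case=> [|]] => // k4; rewrite (tnth_nth set0)//=.
  exact: measurableI.
have -> : (fun w => Z i w * Z j w) =
    (fun w => \sum_k tnth a k * \1_(tnth B k) w).
  apply/funext => w; rewrite !ZE !big_ord_recr big_ord0 !(tnth_nth 0) !(tnth_nth set0)/=.
  rewrite !indicE in_setI in_setT; case: (_ \in _); case: (_ \in _) => /=; ring.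
rewrite Rintegral_sum => [|k]; last first.
  have := integrableZl measurableT (tnth a k) (i1 _ (mB k)).
  by apply: eq_integrable => // w _.
rewrite (eq_bigr (fun k => tnth a k * fine (P (tnth B k)))); last first.
  by move=> k _; rewrite RintegralZl ?E1//; exact: i1.
rewrite !big_ord_recr big_ord0 !(tnth_nth 0) !(tnth_nth set0)/=.
by rewrite PAA// !PA [P setT]probability_setT/=; lra.
Qed.

(** Expanding the square, the products of distinct centred variables have mean
zero by pairwise independence, and each of the [k] squares is at most [1]. *)
Lemma bernoulli_second_moment (k : nat) :
  \int[P]_w ((\sum_(i < k) ((xi i w)%:R - p)) ^+ 2) <= k%:R.
Proof.
have -> : (fun w => (\sum_(i < k) ((xi i w)%:R - p)) ^+ 2) =
    (fun w => \sum_(ij : 'I_k * 'I_k) Z ij.1 w * Z ij.2 w).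
  apply/funext => w; rewrite expr2 mulr_suml.
  under eq_bigr do rewrite mulr_sumr.
  by rewrite pair_big.
rewrite Rintegral_sum; last by move=> [i j]; exact: iZZ.
apply: (@le_trans _ _ (\sum_(ij : 'I_k * 'I_k) (ij.1 == ij.2)%:R)).
  by apply: ler_sum => -[i j] _; exact: EZZ.
rewrite -(pair_big xpredT xpredT (fun i j : 'I_k => (i == j)%:R))/=.
rewrite (eq_bigr (fun=> 1)); first by rewrite sumr_const card_ord.
move=> i _; rewrite (bigD1 i)//= eqxx big1 ?addr0// => j.
by rewrite eq_sym => /negbTE ->.
Qed.

Lemma measurable_bernoulli_tail (k : nat) (r : R) :
  measurable [set w | r <= `|\sum_(i < k) ((xi i w)%:R - p)|].
Proof.
rewrite -[X in measurable X]setTI; apply: (measurable_fun_le (f := fun=> r)) => //.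
by apply: measurableT_comp => //; apply: measurable_sum => i; exact: mZ.
Qed.

Lemma bernoulli_tail (k : nat) (r : R) : 0 < r ->
  (P [set w | (r <= `|\sum_(i < k) ((xi i w)%:R - p)|)%R] <= (k%:R / r ^+ 2)%:E)%E.
Proof.
move=> r0; apply: (chebyshev_sq _ k%:R) => //; last exact: bernoulli_second_moment.
  by apply: measurable_sum => i; exact: mZ.
move=> w; apply: le_trans (ler_norm_sum _ _ _) _.
apply: (@le_trans _ _ (\sum_(i < k) 1)); first by apply: ler_sum => i _; exact: Z1.
by rewrite sumr_const card_ord.
Qed.

End Bernoulli.

(** * Laws of large numbers for Bernoulli sums and for the initial values *)

Section LLN.
Context {d : measure_display} {Omega : measurableType d} {R : realType}.
Variable P : probability Omega R.

(** The sum up to the integer part of [n x] turns the Bernoulli sums into a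
process in continuous time; the integer part costs at most [1], which
divided by [n] vanishes. *)
Lemma bernoulli_lln (p : R) (xi : nat -> Omega -> bool) (x e : R) :
  0 <= p <= 1 -> iid_bernoulli P p xi -> 0 <= x -> 0 < e ->
  whp P (fun n => [set w |
    `|\sum_(i < Num.truncn (n%:R * x)) (xi i w)%:R / n%:R - p * x| <= e]).
Proof.
move=> p01 hxi x0 e0; have /andP[p0 p1] := p01.
have e20 : 0 < e / 2 by rewrite divr_gt0.
pose k n := Num.truncn (n%:R * x).
have kP n : (k n)%:R <= n%:R * x < (k n).+1%:R by apply: truncn_itv; rewrite mulr_ge0.
pose G n := [set w | `|\sum_(i < k n) ((xi i w)%:R - p)| < n%:R * (e / 2)].
have hG : whp P G.
  apply: (whp_bound P _ (fun n => x / (e / 2) ^+ 2 * n%:R^-1)).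
    exists 1%N => // n /= n0; have n0' : 0 < n%:R :> R by rewrite ltr0n.
    have r0 : 0 < n%:R * (e / 2) by rewrite mulr_gt0.
    have -> : ~` G n = [set w | n%:R * (e / 2) <= `|\sum_(i < k n) ((xi i w)%:R - p)|].
      apply/seteqP; split=> w /=; first by move/negP; rewrite -leNgt.
      by move=> H; apply/negP; rewrite -leNgt.
    split; first exact: (measurable_bernoulli_tail P p xi hxi).
    apply: le_trans (bernoulli_tail P p xi p01 hxi _ _ r0) _.
    rewrite lee_fin exprMn ler_pdivrMr ?mulr_gt0 ?exprn_gt0//.
    have -> : x / (e / 2) ^+ 2 / n%:R * (n%:R ^+ 2 * (e / 2) ^+ 2) = n%:R * x.
      by field; rewrite !gt_eqF.
    by case/andP: (kP n).
  rewrite -(mulr0 (x / (e / 2) ^+ 2)); apply: cvgM; first exact: cvg_cst.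
  exact: cvg_inv_natr.
apply: whp_imp hG.
have [N _ HN] := nbhs_infty_gtr (2 / e).
exists N.+1 => // n /= Nn w /= H.
have n0 : 0 < n%:R :> R by rewrite ltr0n (leq_trans _ Nn).
have /= ne := HN n (ltnW Nn).
rewrite -mulr_suml -(ler_pM2l n0) -[X in X * `|_|](gtr0_norm n0) -normrM.
rewrite mulrBr mulrCA divff ?gt_eqF// mulr1.
have -> : \sum_(i < k n) (xi i w)%:R =
    \sum_(i < k n) ((xi i w)%:R - p) + p * (k n)%:R :> R.
  by rewrite big_split/= sumr_const card_ord mulNrn -(mulr_natr p) subrK.
have /andP[kn1 kn2] := kP n; rewrite -natr1 in kn2.
set s := \sum_(i < k n) _.
have : 1 <= n%:R * (e / 2).
  by move: ne; rewrite ltr_pdivrMr// mulrA ler_pdivlMr// => /ltW; rewrite mul1r.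
move: H; rewrite /G /= ltr_norml -/s => /andP[H1 H2] H3.
rewrite ler_norml; move: H1 H2 H3 kn1 kn2.
set a := n%:R * (e / 2); set b := n%:R * x.
have -> : n%:R * e = a + a by rewrite /a; field.
have -> : n%:R * (p * x) = p * b by rewrite /b; ring.
by move=> *; apply/andP; split; nra.
Qed.

(** Sums of nonnegative terms are nondecreasing in the number of terms, so
[whp_monotone_uniform] applies; [k] terms are read at the point [k / n]. *)
Lemma bernoulli_flln (p : R) (xi : nat -> Omega -> bool) (K e : R) :
  0 <= p <= 1 -> iid_bernoulli P p xi -> 0 < K -> 0 < e ->
  whp P (fun n => [set w | forall k : nat, k%:R <= n%:R * K ->
    `|(\sum_(i < k) (xi i w)%:R) / n%:R - p * (k%:R / n%:R)| <= e]).
Proof.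
move=> p01 hxi K0 e0; have /andP[p0 p1] := p01.
pose V (y : R) w : R := \sum_(i < Num.truncn y) (xi i w)%:R.
have mono : {ae P, forall w, forall s t : R, 0 <= s -> s <= t -> V s w <= V t w}.
  apply: aeW => w s t s0 st; rewrite /V.
  rewrite -!(big_mkord xpredT (fun i => (xi i w)%:R)).
  rewrite (big_cat_nat (leq0n _) (le_truncn st))//= lerDl.
  by rewrite sumr_ge0.
have lln (x e' : R) : 0 <= x -> 0 < e' ->
    whp P (fun n => [set w | `|V (n%:R * x) w / n%:R - p * x| <= e']).
  move=> x0 e'0; apply: whp_imp (bernoulli_lln p xi x e' p01 hxi x0 e'0).
  by apply: nearW => n w /=; rewrite -mulr_suml.
have := whp_monotone_uniform P V p p0 mono lln K e K0 e0.
apply: whp_imp; exists 1%N => // n /= n0 w /= H k kK.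
have n0' : 0 < n%:R :> R by rewrite ltr0n.
have := H (k%:R / n%:R); rewrite /V (mulrC n%:R) divfK ?gt_eqF// natrK; apply.
by rewrite divr_ge0//= ler_pdivrMr// mulrC.
Qed.

(** The test function [min (|x - l|, e)] has mean tending to [0] and equals [e]
where [X n] is at distance at least [e] from [l]; Markov's inequality
concludes. *)
Lemma cvg_distribution_cst_whp (X : nat -> Omega -> R) (l e : R) :
  (\forall n \near \oo, measurable_fun setT (X n)) ->
  cvg_in_distribution P X (cst l) -> 0 < e ->
  whp P (fun n => [set w | `|X n w - l| <= e]).
Proof.
move=> mX hX e0.
pose f (x : R) := Num.min `|x - l| e.
have cf : continuous f.
  move=> x; apply: (continuous_min (f := fun y : R => `|y - l|) (g := fun=> e));
    last exact: cvg_cst.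
  by apply: cvg_norm; apply: cvgB; [exact: cvg_id|exact: cvg_cst].
have f0e x : 0 <= f x <= e.
  by rewrite /f le_min normr_ge0 (ltW e0) ge_min lexx orbT.
have bf : bounded_fun f.
  exists e; split; first exact: num_real.
  move=> M eM x _ /=; have /andP[? fe] := f0e x.
  by rewrite ger0_norm// (le_trans fe (ltW eM)).
have := hX f cf bf; rewrite (_ : f \o cst l = cst 0); last first.
  by apply/funext => w; rewrite /f /= subrr normr0 min_l// ltW.
rewrite expectation_cst => /fine_cvgP[_ cE].
have mf : measurable_fun setT f by exact: continuous_measurable_fun.
pose G n := [set w | `|X n w - l| < e].
suff : whp P G by apply: whp_imp; apply: nearW => n w /ltW.
apply: (whp_bound P _ (fun n => e^-1 * fine ('E_P[f \o X n])%E)).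
  apply: filterS mX => n mXn.
  have E : ~` G n = [set w | e <= `|X n w - l|].
    apply/seteqP; split=> w /=; first by move/negP; rewrite -leNgt.
    by move=> H; apply/negP; rewrite -leNgt.
  have mG : measurable (~` G n).
    rewrite E -[X in measurable X]setTI.
    apply: (measurable_fun_le (f := fun=> e)) => //.
    by apply: measurableT_comp => //; exact: measurable_funB.
  split=> //; rewrite -[P _]fineK ?fin_num_measure// lee_fin ler_pdivlMl//.
  have := markov_bounded P (f \o X n) e e (~` G n).
  rewrite unlock; apply => //; first exact: measurableT_comp.
  - by move=> w; exact: f0e.
  - exact: ltW.
  - by move=> w; rewrite E /= => H; rewrite /f le_min H lexx.
by rewrite -(mulr0 e^-1); apply: cvgM => //; exact: cvg_cst.
Qed.

End LLN.

(** * The supremum of the deviation *)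

Section Norm.
Context {R : realType}.
Variable nu : R * R -> R.
Hypothesis hnu : is_norm nu.

Lemma norm_nonneg z : 0 <= nu z.
Proof.
have [tri hom _] := hnu.
have := tri z (-1 *: z); rewrite hom normrN1 mul1r scaleN1r subrr.
have -> : nu 0 = 0 by rewrite -(scale0r (0 : R * R)) hom normr0 mul0r.
lra.
Qed.

Definition norm_const : R := nu (1, 0) + nu (0, 1).

Lemma norm_const_ge0 : 0 <= norm_const.
Proof. by rewrite addr_ge0// norm_nonneg. Qed.

(** Subadditivity and homogeneity applied to the expansion of [z] in the canonical
basis. *)
Lemma norm_le_coord z : nu z <= norm_const * (`|z.1| + `|z.2|).
Proof.
have [tri hom _] := hnu; case: z => a b /=.
have -> : (a, b) = a *: (1, 0) + b *: (0, 1) :> R * R.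
  congr pair; rewrite /= /GRing.scale/=; ring.
apply: le_trans (tri _ _) _; rewrite !hom.
have := norm_nonneg (1, 0); have := norm_nonneg (0, 1).
have := normr_ge0 a; have := normr_ge0 b; rewrite /norm_const; nra.
Qed.

End Norm.

Section SupDeviation.
Context {d : measure_display} {Omega : measurableType d} {R : realType}.

(** By right continuity the supremum over [[0, T]] is approached along the rationals
of [[0, T]] together with [T], hence is a countable supremum of measurable
functions of two natural-number valued variables. *)
Lemma measurable_sup_deviation (nu : R * R -> R) (T : R) (X Y : R -> Omega -> nat)
    (a : R) (q s : R -> R) : is_norm nu -> 0 < T ->
  (forall t : R, 0 <= t -> measurable_fun setT (X t) /\ measurable_fun setT (Y t)) ->
  (forall w (t : R), 0 <= t -> \forall u \near t^'+, X u w = X t w /\ Y u w = Y t w) ->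
  (forall t : R, 0 <= t < T -> q u @[u --> t^'+] --> q t) ->
  (forall t : R, 0 <= t < T -> s u @[u --> t^'+] --> s t) ->
  measurable_fun setT (sup_deviation nu T
    (fun t w => (X t w)%:R / a) (fun t w => (Y t w)%:R / a) q s).
Proof.
move=> hnu T0 mXY rXY qr sr.
pose g t w := nu (((X t w)%:R / a, (Y t w)%:R / a) - (q t, s t)).
pose tau (k : nat) : R := if (choice.unpickle k : option rat) is Some r
  then if 0 <= (ratr r : R) <= T then ratr r else T else T.
have tauT k : 0 <= tau k <= T.
  rewrite /tau; case: (choice.unpickle k) => [r|]; last by rewrite lexx ltW.
  by case: ifPn => // _; rewrite lexx ltW.
have -> : sup_deviation nu T
    (fun t w => (X t w)%:R / a) (fun t w => (Y t w)%:R / a) q s =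
    (fun w => esups (fun k => (g (tau k) w)%:E) 0%N).
  apply/funext => w; apply/eqP; rewrite eq_le; apply/andP; split; last first.
    apply: ereal_sup_le => _ [k _ <-]; exists (tau k) => //.
    by rewrite itv_0T.
  apply: ge_ereal_sup => _ [t tT <-].
  have le_tau k : ((g (tau k) w)%:E <= esups (fun k => (g (tau k) w)%:E) 0%N)%E.
    by apply: ereal_sup_ubound; exists k.
  move: tT; rewrite itv_0T => /andP[t0]; rewrite [t <= T]le_eqVlt => /orP[/eqP->|tT].
    (* Any rational outside [[0, T]], here [-1], indexes the end point [T]. *)
    have -> : T = tau (choice.pickle (-1 : rat)); last exact: le_tau.
    by rewrite /tau choice.pickleK rmorphN1 ler0N1.
  apply/lee_addgt0Pr => e e0.
  have tT' : 0 <= t < T by rewrite t0.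
  pose e' := e / (norm_const nu + 1) / 2.
  have C0 := norm_const_ge0 nu hnu.
  have e'0 : 0 < e' by rewrite !divr_gt0// ltr_wpDl.
  have : \forall u \near t^'+, [/\ u < T, X u w = X t w /\ Y u w = Y t w,
      `|q t - q u| <= e' & `|s t - s u| <= e'].
    near=> u; split.
    - near: u; exact: nbhs_right_lt.
    - near: u; exact: rXY.
    - near: u; move/cvgrPdist_le : (qr t tT'); exact.
    - near: u; move/cvgrPdist_le : (sr t tT'); exact.
  move=> [dl /= dl0 hd].
  have [r] := @rat_in_itvoo R t (t + dl) (ltr_pwDr dl0 (lexx _)).
  rewrite in_itv/= => /andP[tr rd].
  have [|rT [Xr Yr] qe se] := hd (ratr r) _ tr.
    by rewrite /= ltr0_norm ?subr_lt0// opprB ltrBlDl.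
  have taur : tau (choice.pickle r) = ratr r.
    by rewrite /tau choice.pickleK (ltW rT) (le_trans t0 (ltW tr)).
  apply: (@le_trans _ _ ((g (ratr r) w)%:E + e%:E)%E); last first.
    by rewrite leeD// -taur.
  rewrite -EFinD lee_fin /g Xr Yr.
  have [tri _ _] := hnu.
  set x := ((X t w)%:R / a, (Y t w)%:R / a).
  have -> : x - (q t, s t) = (x - (q (ratr r), s (ratr r))) +
      ((q (ratr r), s (ratr r)) - (q t, s t)) by rewrite addrA subrK.
  apply: le_trans (tri _ _) _; rewrite lerD2l.
  apply: le_trans (norm_le_coord nu hnu _) _ => /=.
  rewrite (distrC (q _)) (distrC (s _)).
  have -> : e = (norm_const nu + 1) * (e' + e').
    by rewrite /e'; field; rewrite gt_eqF// ltr_wpDl.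
  apply: ler_pM => //; first by rewrite lerDl.
  exact: lerD.
apply: measurable_fun_esups => k.
have /andP[k0 _] := tauT k; have [mX mY] := mXY _ k0.
apply: measurableT_comp => // _ B mB.
have := measurable_nat_rel (X (tau k)) (Y (tau k))
  (fun i j => B (nu ((i%:R / a, j%:R / a) - (q (tau k), s (tau k))))) mX mY.
by rewrite setTI.
Unshelve. all: by end_near. Qed.

End SupDeviation.

(** * Tracking of the fluid limit along one sample path *)

Section Pathwise.
Context {d : measure_display} {Omega : measurableType d} {R : realType}.
Notation leb := (@lebesgue_measure R).
Variables (lambda mu theta gamma p : R) (c n : nat) (w : Omega).
Variables (NA NB NC NAb : R -> Omega -> nat) (xi : nat -> Omega -> bool).
Variables (Q S : R -> Omega -> nat) (T q0 s0 eps : R) (q s : R -> R).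
Hypotheses (lambda0 : 0 < lambda) (mu0 : 0 < mu) (theta0 : 0 < theta)
  (gamma0 : 0 < gamma) (p01 : 0 <= p <= 1) (T0 : 0 < T) (n0 : (0 < n)%N).
Hypothesis rc : forall t : R, 0 <= t ->
  \forall u \near t^'+, Q u w = Q t w /\ S u w = S t w.
Hypothesis S_le : forall t : R, 0 <= t -> (S t w <= n * c)%N.
Hypothesis eqs : forall t : R, 0 <= t ->
  (Q t w)%:R = (Q 0 w)%:R + (NA (lambda * n%:R * t) w)%:R
      - (NB (service_clock mu Q S t w) w)%:R
      - (NAb (abandonment_clock theta Q S t w) w)%:R :> R
    /\
    (S t w)%:R = (S 0 w)%:R + (NC (charging_clock gamma (n * c) S t w) w)%:R
      - \sum_(i < NB (service_clock mu Q S t w) w) (xi i w)%:R :> R.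
Hypothesis fl : fluid_integral lambda mu theta gamma p c q0 s0 T q s.

(** A bound of [Q / n] on [[0, T]]: the initial content and the arrivals up to
time [T], with an error at most [1] in each. *)
Definition queue_bound := `|q0| + lambda * T + 2.

(** A bound common to the four clocks divided by [n], a sum so that each clock is
dominated by one of its terms. *)
Definition clock_bound :=
  1 + lambda * T + mu * (c%:R * T) + gamma * (c%:R * T)
    + theta * (queue_bound * T).

Hypothesis eps01 : 0 < eps <= 1.
Let close (N : R -> Omega -> nat) := forall x, 0 <= x <= clock_bound ->
  `|(N (n%:R * x) w)%:R / n%:R - x| <= eps.
Hypotheses (hA : close NA) (hB : close NB) (hC : close NC) (hAb : close NAb).
Hypothesis hxi : forall k : nat, k%:R <= n%:R * (clock_bound + 1) ->
  `|(\sum_(i < k) (xi i w)%:R) / n%:R - p * (k%:R / n%:R)| <= eps.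
Hypothesis hQ0 : `|(Q 0 w)%:R / n%:R - q0| <= eps.
Hypothesis hS0 : `|(S 0 w)%:R / n%:R - s0| <= eps.

Let X t : R := (Q t w)%:R / n%:R.
Let Y t : R := (S t w)%:R / n%:R.

Let N0 : 0 < n%:R :> R. Proof. by rewrite ltr0n. Qed.

Let X0 t : 0 <= X t. Proof. by rewrite divr_ge0. Qed.
Let Y0 t : 0 <= Y t. Proof. by rewrite divr_ge0. Qed.

Let Yc (t : R) : 0 <= t -> Y t <= c%:R.
Proof.
by move=> t0; rewrite ler_pdivrMr// -natrM ler_nat mulnC S_le.
Qed.

Let queue_bound_ge0 : 0 <= queue_bound.
Proof. by rewrite /queue_bound !addr_ge0// mulr_ge0// ltW. Qed.

Let in_clock (x : R) : 0 <= x ->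
  [\/ x <= lambda * T, x <= mu * (c%:R * T), x <= gamma * (c%:R * T)
    | x <= theta * (queue_bound * T)] -> 0 <= x <= clock_bound.
Proof.
move=> x0 H; rewrite x0 /clock_bound /=.
have h1 : 0 <= lambda * T by rewrite mulr_ge0// ltW.
have h2 : 0 <= mu * (c%:R * T) by rewrite !mulr_ge0// ltW.
have h3 : 0 <= gamma * (c%:R * T) by rewrite !mulr_ge0// ltW.
have h4 : 0 <= theta * (queue_bound * T) by rewrite !mulr_ge0// ltW.
by case: H; lra.
Qed.

Let arrival_clock (t : R) : 0 <= t <= T ->
  `|(NA (lambda * n%:R * t) w)%:R / n%:R - lambda * t| <= eps.
Proof.
move=> /andP[t0 tT]; have -> : lambda * n%:R * t = n%:R * (lambda * t) by ring.
apply: hA; apply: in_clock; first by rewrite mulr_ge0// ltW.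
by apply: Or41; rewrite ler_pM2l.
Qed.

(* Services and abandonments only decrease the queue.  The bound must come from
   the equation, because the abandonment integral is controlled only once the
   path is known to be bounded. *)
Let X_le (t : R) : 0 <= t <= T -> X t <= queue_bound.
Proof.
move=> tT; have /andP[t0 t_T] := tT.
have H : X t <= (Q 0 w)%:R / n%:R + (NA (lambda * n%:R * t) w)%:R / n%:R.
  rewrite -mulrDl ler_pM2r ?invr_gt0// (eqs _ t0).1 -addrA -opprD.
  by rewrite gerBl// addr_ge0.
have := arrival_clock _ tT; rewrite ler_norml => /andP[_ HA].
have := hQ0; rewrite ler_norml => /andP[_ HQ].
have lt : lambda * t <= lambda * T by rewrite ler_pM2l.
have := ler_norm q0; have /andP[_ e1] := eps01; rewrite /queue_bound; lra.
Qed.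

Let bX : bounded_measurable T X.
Proof.
split.
  apply: (measurable_fun_right_constant _ T (fun t => Q t w) (fun k : nat => k%:R / n%:R)).
  by move=> t /rc; apply: filterS => u [].
by exists queue_bound => t tT; rewrite ger0_norm//; exact: X_le.
Qed.

Let bY : bounded_measurable T Y.
Proof.
split.
  apply: (measurable_fun_right_constant _ T (fun t => S t w) (fun k : nat => k%:R / n%:R)).
  by move=> t /rc; apply: filterS => u [].
by exists c%:R => t /andP[t0 _]; rewrite ger0_norm//; exact: Yc.
Qed.

Let bmin : bounded_measurable T (fun u => Num.min (X u) (Y u)).
Proof.
split; first by apply: measurable_minr; [case: bX|case: bY].
exists c%:R => t /andP[t0 _]; rewrite ger0_norm ?le_min ?X0 ?Y0//.
by rewrite ge_min Yc// orbT.
Qed.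

Let bmax : bounded_measurable T (fun u => Num.max (X u - Y u) 0).
Proof.
split.
  apply: measurable_maxr; last exact: measurable_cst.
  by apply: measurable_funB; [case: bX|case: bY].
exists queue_bound => t tT; rewrite ger0_norm ?le_max ?lexx ?orbT//.
rewrite ge_max queue_bound_ge0 andbT.
by rewrite (le_trans _ (X_le _ tT))// gerBl.
Qed.

Let bcY : bounded_measurable T (fun u => c%:R - Y u).
Proof. by apply: bounded_measurableB => //; exact: bounded_measurable_cst. Qed.

Let I1 t := \int[leb]_(u in `[0, t]) Num.min (X u) (Y u).
Let I2 t := \int[leb]_(u in `[0, t]) Num.max (X u - Y u) 0.
Let I3 t := \int[leb]_(u in `[0, t]) (c%:R - Y u).

Let integral_bounds (f : R -> R) (C t : R) : 0 <= t <= T ->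
  bounded_measurable T f -> (forall u : R, 0 <= u <= T -> 0 <= f u <= C) ->
  0 <= \int[leb]_(u in `[0, t]) f u <= C * T.
Proof.
move=> /andP[t0 tT] bf fC.
have fC' u : `[0, t]%classic u -> 0 <= f u <= C.
  by rewrite itv_0T => /andP[u0 ut]; apply: fC; rewrite u0 (le_trans ut).
have C0 : 0 <= C by have /andP[] := fC 0 (introT andP (conj (lexx _) (ltW T0))); apply: le_trans.
apply/andP; split; first by apply: Rintegral_ge0 => u /fC'/andP[].
apply: (@le_trans _ _ (\int[leb]_(u in `[0, t]) C)).
  apply: le_Rintegral => //.
  - exact: (bounded_measurable_integrable T).
  - exact: (bounded_measurable_integrable T _ _ (bounded_measurable_cst _ _)).
  - by move=> u /fC'/andP[].
by rewrite Rintegral_cst_0t// ler_wpM2l.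
Qed.

Let integralZn (f g : R -> R) (t : R) : 0 <= t <= T -> bounded_measurable T g ->
  (forall u, f u = n%:R * g u) ->
  \int[leb]_(u in `[0, t]) f u = n%:R * \int[leb]_(u in `[0, t]) g u.
Proof.
move=> /andP[t0 tT] bg fg; under eq_Rintegral do rewrite fg.
by rewrite RintegralZl//; exact: (bounded_measurable_integrable T).
Qed.

Let nXE t : (Q t w)%:R = n%:R * X t :> R.
Proof. by rewrite /X mulrCA divff ?mulr1// gt_eqF. Qed.

Let nYE t : (S t w)%:R = n%:R * Y t :> R.
Proof. by rewrite /Y mulrCA divff ?mulr1// gt_eqF. Qed.

Let service_clockE (t : R) : 0 <= t <= T ->
  service_clock mu Q S t w = n%:R * (mu * I1 t).
Proof.
move=> tT; rewrite /service_clock.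
rewrite (integralZn _ (fun u => Num.min (X u) (Y u)) t tT bmin); first by rewrite mulrCA.
by move=> u; rewrite minr_pMr// -nXE -nYE natr_min.
Qed.

Let abandonment_clockE (t : R) : 0 <= t <= T ->
  abandonment_clock theta Q S t w = n%:R * (theta * I2 t).
Proof.
move=> tT; rewrite /abandonment_clock.
rewrite (integralZn _ (fun u => Num.max (X u - Y u) 0) t tT bmax); first by rewrite mulrCA.
by move=> u; rewrite maxr_pMr// mulr0 mulrBr -nXE -nYE.
Qed.

Let charging_clockE (t : R) : 0 <= t <= T ->
  charging_clock gamma (n * c) S t w = n%:R * (gamma * I3 t).
Proof.
move=> tT; rewrite /charging_clock.
rewrite (integralZn _ (fun u => c%:R - Y u) t tT bcY); first by rewrite mulrCA.
by move=> u; rewrite mulrBr -nYE natrM.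
Qed.

Let drift_q_integral (t : R) : 0 <= t <= T ->
  \int[leb]_(u in `[0, t]) drift_q lambda mu theta (X u, Y u)
  = lambda * t - mu * I1 t - theta * I2 t.
Proof.
move=> /andP[t0 tT]; rewrite /drift_q /=.
rewrite (bounded_measurable_RintegralB T)//; last 2 first.
- by apply: bounded_measurableB; [exact: bounded_measurable_cst|exact: bounded_measurableZ].
- exact: bounded_measurableZ.
rewrite (bounded_measurable_RintegralB T)//; last 2 first.
- exact: bounded_measurable_cst.
- exact: bounded_measurableZ.
by rewrite Rintegral_cst_0t// !(bounded_measurable_RintegralZ T).
Qed.

Let drift_s_integral (t : R) : 0 <= t <= T ->
  \int[leb]_(u in `[0, t]) drift_s mu gamma p c (X u, Y u)
  = gamma * I3 t - p * mu * I1 t.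
Proof.
move=> /andP[t0 tT]; rewrite /drift_s /=.
rewrite (bounded_measurable_RintegralB T)//; last 2 first.
- exact: bounded_measurableZ.
- exact: bounded_measurableZ.
by rewrite !(bounded_measurable_RintegralZ T).
Qed.

(** On the event where all drivers are within [eps] of their means, each
coordinate of the scaled path solves the fluid integral equation up to
[4 * eps]: four sources of error for the queue (initial value, arrivals,
services, abandonments), and four for the servers (initial value, charging,
services, Bernoulli sum).  Then [ode_stability] applies with [8 * eps]. *)
Lemma pathwise_fluid_bound (t : R) : 0 <= t <= T ->
  `|X t - q t| + `|Y t - s t| <=
    (eps *+ 8) *+ 2 * expR (drift_lip mu theta gamma *+ 2 * T).
Proof.
have [bq bs qs] := fl; have /andP[e0 e1] := eps01.
have /andP[p0 p1] := p01.
have L0 := drift_lip_gt0 mu theta gamma mu0 theta0 gamma0.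
move=> tT; apply: le_trans (_ : _ <=
    (eps *+ 8) *+ 2 * expR (drift_lip mu theta gamma *+ 2 * t)) _; last first.
  rewrite ler_wpM2l//; first by rewrite !mulrn_wge0// ltW.
  rewrite ler_expR ler_wpM2l//; first by rewrite mulrn_wge0// ltW.
  by case/andP: tT.
apply: (ode_stability (drift_q lambda mu theta) (drift_s mu gamma p c)
  (drift_lip mu theta gamma) L0
  (drift_lipP lambda mu theta gamma p c mu0 theta0 gamma0 p01)
  (measurable_drift_q lambda mu theta) (measurable_drift_s mu gamma p c)
  T (eps *+ 8) X Y q s) => // {tT}t tT.
have /andP[t0 t_T] := tT.
have [-> ->] := qs _ tT.
rewrite drift_q_integral// drift_s_integral//.
set Jq := \int[leb]_(u in _) _; set Js := \int[leb]_(u in _) _.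
have b1 : 0 <= I1 t <= c%:R * T.
  apply: integral_bounds => // u /andP[u0 _].
  by rewrite le_min X0 Y0 ge_min Yc// orbT.
have b2 : 0 <= I2 t <= queue_bound * T.
  apply: integral_bounds => // u uT; rewrite le_max lexx orbT ge_max queue_bound_ge0 andbT.
  by rewrite (le_trans _ (X_le _ uT))// gerBl.
have b3 : 0 <= I3 t <= c%:R * T.
  apply: integral_bounds => // u /andP[u0 _].
  by rewrite subr_ge0 Yc//= gerBl.
have cB : 0 <= mu * I1 t <= clock_bound.
  have /andP[? ?] := b1; apply: in_clock; first by rewrite mulr_ge0// ltW.
  by apply: Or42; rewrite ler_pM2l.
have cAb : 0 <= theta * I2 t <= clock_bound.
  have /andP[? ?] := b2; apply: in_clock; first by rewrite mulr_ge0// ltW.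
  by apply: Or44; rewrite ler_pM2l.
have cC : 0 <= gamma * I3 t <= clock_bound.
  have /andP[? ?] := b3; apply: in_clock; first by rewrite mulr_ge0// ltW.
  by apply: Or43; rewrite ler_pM2l.
have eA := arrival_clock _ tT.
have eB := hB _ cB; have eAb := hAb _ cAb; have eC := hC _ cC.
have [EQ ES] := eqs _ t0.
move: EQ ES; rewrite service_clockE// abandonment_clockE// charging_clockE//.
set a := (NA _ w)%:R in eA *; set kB := NB _ w in eB *.
set ab := (NAb _ w)%:R in eAb *; set cc := (NC _ w)%:R in eC *.
move=> EQ ES.
(* The number of Bernoulli variables used is the number of services, which
   exceeds [n] times its clock by at most [n * eps]; this is why the range of
   the Bernoulli hypothesis is longer by one. *)
have exi : `|(\sum_(i < kB) (xi i w)%:R) / n%:R - p * (kB%:R / n%:R)| <= eps.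
  apply: hxi; rewrite -ler_pdivrMl// mulrC.
  move: eB; rewrite ler_norml => /andP[_]; have /andP[_] := cB; lra.
have XE : X t = (Q 0 w)%:R / n%:R + a / n%:R - kB%:R / n%:R - ab / n%:R.
  by rewrite /X EQ; ring.
have YE : Y t = (S 0 w)%:R / n%:R + cc / n%:R - (\sum_(i < kB) (xi i w)%:R) / n%:R.
  by rewrite /Y ES; ring.
rewrite XE YE.
move: eA eB eAb eC exi hQ0 hS0.
set a' := a / _; set b' := kB%:R / _; set ab' := ab / _; set c' := cc / _.
set x' := (\sum_(i < kB) _) / _; set Q' := _ / _; set S' := _ / _.
rewrite !ler_norml => eA eB eAb eC exi eQ eS.
have epb : - eps <= p * (b' - mu * I1 t) <= eps.
  rewrite -ler_norml normrM ger0_norm//; apply: le_trans (_ : 1 * eps <= _); last by rewrite mul1r.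
  by apply: ler_pM => //; rewrite ler_norml.
apply: (@le_trans _ _ (eps *+ 4 + eps *+ 4)); last by rewrite -mulrnDr.
apply: lerD; rewrite ler_norml; lra.
Qed.

End Pathwise.

(** * The fluid limit *)

Lemma derivable_oo_right_continuous {R : realType} (T : R) (f : R -> R) :
  derivable_oo_LRcontinuous f 0 T ->
  forall t : R, 0 <= t < T -> f u @[u --> t^'+] --> f t.
Proof.
move=> [df f0 _] t /andP[]; rewrite le_eqVlt => /predU1P[<-//|t0 tT].
apply: cvg_at_right_filter; apply/differentiable_continuous/derivable1_diffP.
by apply: df; rewrite in_itv/= t0.
Qed.

Theorem theorem3p1 (R : realType) (d : measure_display)
    (Omega : measurableType d) (P : probability Omega R)
    (lambda mu theta gamma p : R) (c : nat)
    (NA NB NC NAb : R -> Omega -> nat) (xi : nat -> Omega -> bool)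
    (Q S : nat -> R -> Omega -> nat) (q0 s0 : R) (nu : R * R -> R) (T : R) :
  0 < lambda -> 0 < mu -> 0 < theta -> 0 < gamma -> 0 <= p <= 1 ->
  (0 < c)%N ->
  erlang_drivers P p NA NB NC NAb xi ->
  (forall n, (0 < n)%N ->
    erlang_Sstar P lambda mu theta gamma c n NA NB NC NAb xi (Q n) (S n)) ->
  cvg_in_distribution P (fun n w => (Q n 0 w)%:R / n%:R) (cst q0) ->
  cvg_in_distribution P (fun n w => (S n 0 w)%:R / n%:R) (cst s0) ->
  is_norm nu ->
  0 < T ->
  exists q s : R -> R,
    [/\ fluid_solution lambda mu theta gamma p c q0 s0 T q s,
        forall q' s' : R -> R,
          fluid_solution lambda mu theta gamma p c q0 s0 T q' s' ->
          forall t : R, 0 <= t <= T -> q' t = q t /\ s' t = s t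
      & cvg_in_probability P
          (fun n => sup_deviation nu T
             (fun t w => (Q n t w)%:R / n%:R) (fun t w => (S n t w)%:R / n%:R)
             q s) 0].
Proof.
move=> lambda0 mu0 theta0 gamma0 p01 c0 [[hNA hNB] [hNC hNAb] hxi _] hES
  hQ0 hS0 hnu T0.
have [q [s sol]] :=
  fluid_exists lambda mu theta gamma p c mu0 theta0 gamma0 p01 q0 s0 T T0.
have to_int q' s' := @fluid_solution_integral _ lambda mu theta gamma p c
  mu0 theta0 gamma0 p01 q0 s0 T q' s' T0.
have fl := to_int q s sol.
exists q, s; split=> //.
  move=> q' s' sol'; apply: (fluid_unique _ _ _ _ _ _ mu0 theta0 gamma0 p01 _ _ _ _ _ _ _ fl).
  exact: to_int.
have mX : \forall n \near \oo, measurable_fun setT (sup_deviation nu T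
    (fun t w => (Q n t w)%:R / n%:R) (fun t w => (S n t w)%:R / n%:R) q s).
  exists 1%N => // n /= n0; have es := hES n n0.
  have [_ dq ds _] := sol.
  apply: measurable_sup_deviation => //.
  - exact: (es_measurable es).
  - exact: (es_right_continuous es).
  - exact: derivable_oo_right_continuous dq.
  - exact: derivable_oo_right_continuous ds.
split=> // e e0.
(* On the event constructed below the deviation is at most [eps * E]. *)
pose E := norm_const nu * (8%:R *+ 2 * expR (drift_lip mu theta gamma *+ 2 * T)).
have E0 : 0 <= E.
  by rewrite !mulr_ge0 ?norm_const_ge0 ?mulrn_wge0 ?expR_ge0.
pose eps := Num.min 1 (e / (E + 1)).
have eps0 : 0 < eps by rewrite lt_min ltr01 divr_gt0// ltr_wpDl.
have eps1 : 0 < eps <= 1 by rewrite eps0 ge_min lexx.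
have epsE : eps * E <= e.
  apply: (@le_trans _ _ (e / (E + 1) * E)).
    by rewrite ler_wpM2r// ge_min lexx orbT.
  rewrite mulrAC ler_pdivrMr ?ltr_wpDl// ler_wpM2l ?lerDl//; exact: ltW.
pose K := clock_bound lambda mu theta gamma c T q0.
have K0 : 0 < K.
  rewrite /K /clock_bound /queue_bound -!addrA ltr_pwDl// !addr_ge0//.
  - by rewrite mulr_ge0// ltW.
  - by rewrite !mulr_ge0// ltW.
  - by rewrite !mulr_ge0// ltW.
  - by rewrite !mulr_ge0 ?addr_ge0 ?mulr_ge0// ltW.
have hA := poisson_flln P NA K eps hNA K0 eps0.
have hB := poisson_flln P NB K eps hNB K0 eps0.
have hC := poisson_flln P NC K eps hNC K0 eps0.
have hAb := poisson_flln P NAb K eps hNAb K0 eps0.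
have hX := bernoulli_flln P p xi (K + 1) eps p01 hxi (ltr_wpDl (ltW K0) ltr01) eps0.
have mdiv (N : Omega -> nat) (a : R) : measurable_fun setT N ->
    measurable_fun setT (fun w => (N w)%:R / a : R).
  move=> mN _ B mB; rewrite setTI.
  exact: (measurable_nat_rel N N (fun i _ => B (i%:R / a)) mN mN).
have hq : whp P (fun n => [set w | `|(Q n 0 w)%:R / n%:R - q0| <= eps]).
  apply: cvg_distribution_cst_whp hQ0 eps0; exists 1%N => // n /= n0.
  by apply: mdiv; case: (es_measurable (hES n n0) (lexx 0)).
have hs : whp P (fun n => [set w | `|(S n 0 w)%:R / n%:R - s0| <= eps]).
  apply: cvg_distribution_cst_whp hS0 eps0; exists 1%N => // n /= n0.
  by apply: mdiv; case: (es_measurable (hES n n0) (lexx 0)).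
have heqs := whp_ae P _ (fun n n0 => es_equations (hES n n0)).
pose G n := [set w | forall t : R, 0 <= t <= T ->
  nu (((Q n t w)%:R / n%:R, (S n t w)%:R / n%:R) - (q t, s t)) <= e].
have hG : whp P G.
  have := whp_and _ _ _ (whp_and _ _ _ (whp_and _ _ _ hA hB) (whp_and _ _ _ hC hAb))
    (whp_and _ _ _ (whp_and _ _ _ hX heqs) (whp_and _ _ _ hq hs)).
  apply: whp_imp; exists 1%N => // n /= n0 w.
  move=> [[[HA HB] [HC HAb]] [[HX Heq] [Hq Hs]]] t tT.
  apply: le_trans (norm_le_coord nu hnu _) _ => /=.
  have := pathwise_fluid_bound lambda mu theta gamma p c n w NA NB NC NAb xi
    (Q n) (S n) T q0 s0 eps q s lambda0 mu0 theta0 gamma0 p01 T0 n0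
    (es_right_continuous (hES n n0) w) (es_range (hES n n0) w) Heq fl eps1
    HA HB HC HAb HX Hq Hs t tT.
  move=> /(ler_wpM2l (norm_const_ge0 nu hnu)) /le_trans; apply.
  apply: le_trans epsE; rewrite le_eqVlt; apply/orP; left; apply/eqP.
  by rewrite /E -(mulr_natr eps 8); ring.
apply: whp_measure_cvg0 hG _; apply: filterS mX => n mXn; split.
  under eq_fun do rewrite sube0.
  rewrite -[X in measurable X]setTI.
  have mabs := measurableT_comp (@abse_measurable R setT) mXn.
  exact: (emeasurable_fun_o_infty measurableT mabs).
move=> w /= + Gw; apply/negP; rewrite -leNgt sube0 gee0_abs.
  by apply: ge_ereal_sup => _ [t tT <-]; rewrite lee_fin; apply: Gw; rewrite -itv_0T.
apply: le_trans (ereal_sup_ubound _); last first.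
  by exists 0 => //; rewrite itv_0T lexx ltW.
by rewrite lee_fin norm_nonneg.
Qed.
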